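(* Let $v\in[0,1]$ and let $T\ge 2$ be a horizon for which the Shrinking-Time-Window Policy $\pi^{\mathrm{shrinking}}$ (with scaling constants $\kappa>0$ and $\gamma$ sufficiently large, as specified in the context; the policy is not given $v$) is well defined. Then its worst-case regret over $\mathcal{D}(v)$ satisfies $$\mathcal{R}^{\pi^{\mathrm{shrinking}}}(T)\le C\,T^{(3+v)/4}\log^{5/2}T,$$ where $C\le 3\max\{b_{\max},h_{\max}\}(\delta+Q_{\max})+12e^{1/4}\ell(\gamma+\sqrt{\kappa})+e^{1/4}C_0$, with $C_0= 3\max\{b_{\max},h_{\max}\}(\delta + Q_{\max})+\ell\left(2\sqrt{\kappa}+\sqrt{\frac{\pi}{36e}}\,\frac{\delta}{\sqrt{\kappa}}\right)$.
   Context: **Nonstationary Newsvendor.** Fixed problem data: a set $Q\subset\mathbb{R}_{\ge 0}$ bounded above by $Q_{\max}$; known per-unit underage costs $b_t\in[0,b_{\max}]$ and overage costs $h_t\in[0,h_{\max}]$; a known family of distributions $\mathcal{D}=\{\mathcal{D}_\mu:\mu\in[\mu_{\min},\mu_{\max}]\}$ parameterized by its mean, $\mu=\mathbb{E}[\mathcal{D}_\mu]$, each member being sub-Gaussian. A random variable $X$ has sub-Gaussian norm $\|X\|_{\psi_2}$ if $\mathbb{P}(|X|>x)\le 2\exp(-x^2/\|X\|_{\psi_2}^2)$ for all $x\ge0$. Put $\delta=\sup_{\mathcal{D}_\mu\in\mathcal{D}}\|\mathcal{D}_\mu\|_{\psi_2}$. Let $C(\mu,b,h,q)=\mathbb{E}_{d\sim\mathcal{D}_\mu}[b(d-q)^++h(q-d)^+]$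 and $C_t(\mu,q)=C(\mu,b_t,h_t,q)$, where $x^+=\max\{0,x\}$. Lipschitz assumption: there is $\ell$ with $|C(\mu_1,b,h,q)-C(\mu_2,b,h,q)|\le\ell|\mu_1-\mu_2|$ for all $\mu_1,\mu_2\in[\mu_{\min},\mu_{\max}]$, $b\in[0,b_{\max}]$, $h\in[0,h_{\max}]$, $q\in Q$. All argmins over $Q$ are assumed nonempty. In each period $t=1,\dots,T$ the decision-maker selects $q_t\in Q$, then $d_t$ is drawn from an unknown $D_t=\mathcal{D}_{\mu_t}\in\mathcal{D}$ (independently over time) and observed. A policy $\pi=(\pi_1,\dots,\pi_T)$ is a sequence of mappings, $\pi_t$ taking $d_1,\dots,d_{t-1}$ to $q_t\in Q$. Demand variation of $\bm{\mu}=(\mu_1,\dots,\mu_T)$: $V_{\bm\mu}=\max\sum_{k=1}^K|\mu_{t_k}-\mu_{t_{k-1}}|^2$, the maximum being over $0\le K\le T-1$ and all $1\le t_0<\dots<t_K\le T$. For $v\in[0,1]$, $\mathcal{D}(v)=\{(D_1,\dots,D_T): D_t\in\mathcal{D}\ \forall t,\ V_{\bm\mu}\le T^v\}$. With $q_t^*\in\arg\min_{q\in Q}C_t(\mu_t,q)$, the worst-case regret is $$\mathcal{R}^\pi(T)=\sup_{\bm D\in\mathcal{D}(v)}\mathbb{E}^\pi_{\bm D}\Big[\sum_{t=1}^T\big(C_t(\mu_t,q_t)-C_t(\mu_t,q_t^* )\big)\Big].$$ **Shrinking-Time-Window Policy.** Inputs: $\kappa>0$ and $\gamma>0$ sufficiently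 large, namely $\rho\kappa\gamma^2/\delta_\epsilon^2\ge 5/2$, where $\delta_\epsilon$ is an upper bound on the sub-Gaussian norms of the noises $\epsilon_t=d_t-\mu_t$ and $\rho>0$ is the universal constant in Hoeffding's inequality: $\mathbb{P}(|\frac1n\sum_{i=1}^n\epsilon_i|\ge x)\le 2\exp(-\rho n x^2/K^2)$ for independent mean-zero $\epsilon_i$ with sub-Gaussian norm at most $K$. Let $v_j=(1+\frac1{\log T})^{j-1}\frac1{\log T}$ for $j=1,\dots,k$, with $k$ chosen so that $v_{k-1}<1\le v_k$; let $n_j=\lceil\kappa T^{(1-v_j)/2}\rceil$; and let $\hat\mu_t^j=\frac1{n_j}\sum_{s=t-n_j}^{t-1}d_s$, rounded to the nearest value in $[\mu_{\min},\mu_{\max}]$. For $t=1,\dots,T^{3/4}$ select $q_t\in Q$ arbitrarily ($T^{3/4}$ is treated as an integer, i.e. rounded). Then set $i\leftarrow1$, $t_{\mathrm{if}}\leftarrow T^{3/4}+1$, and for $t=T^{3/4}+1,\dots,T$: if $\sum_{s=t_{\mathrm{if}}}^t|\hat\mu_s^i-\hat\mu_s^j|\ge 2(\gamma\sqrt{\log T}+\sqrt\kappa)T^{(3+v_j)/4}$ for some $j>i$ ($j\le k$), set $i\leftarrow i+1$ and $t_{\mathrm{if}}\leftarrow t$; then select $q_t\in\arg\min_{q\in Q}C_t(\hat\mu_t^i,q)$. The policy is well defined when $n_1\le T^{3/4}$. $\log$ is the natural logarithm. *)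

(* Defs.v *)
From HB Require Import structures.
From mathcomp Require Import all_boot all_order all_algebra.
From mathcomp Require Import all_classical all_reals all_analysis.

Set Implicit Arguments.
Unset Strict Implicit.
Unset Printing Implicit Defensive.

Import Order.TTheory GRing.Theory Num.Theory.
Import numFieldNormedType.Exports.

Local Open Scope classical_set_scope.
Local Open Scope ring_scope.

Section Probability.
Context {R : realType}.

(* The infimum of the admissible constants; K must be positive because
   x / 0 = 0 would make the tail bound trivially true at K = 0. *)
Definition subgaussian_norm d (Omega : measurableType d)
    (P : probability Omega R) (X : Omega -> R) : \bar R :=
  ereal_inf [set K%:E | K in [set K : R | 0 < K /\
    forall x : R, 0 <= x ->
      (P [set w | x < `|X w|]%R <= (2 * expR (- (x ^+ 2 / K ^+ 2)))%:E)%E]].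

Definition mutually_independent d (Omega : measurableType d)
    (P : probability Omega R) (I : finType) (X : I -> {RV P >-> R}) : Prop :=
  forall (J : {set I}) (A : I -> set R), (forall i, measurable (A i)) ->
    P (\bigcap_(i in [set` J]) (X i @^-1` A i)) =
    (\prod_(i in J) P (X i @^-1` A i))%E.

Definition hoeffding_constant (rho : R) : Prop :=
  0 < rho /\
  forall (d : measure_display) (Omega : measurableType d)
    (P : probability Omega R) (n : nat) (eps : 'I_n -> {RV P >-> R}) (K x : R),
    (0 < n)%N -> 0 < K -> 0 <= x ->
    mutually_independent eps ->
    (forall i, ('E_P[eps i] = 0)%E) ->
    (forall i, (subgaussian_norm P (eps i) <= K%:E)%E) ->
    (P [set w | x <= `|n%:R^-1 * \sum_(i < n) eps i w|]%R
       <= (2 * expR (- (rho * n%:R * x ^+ 2 / K ^+ 2)))%:E)%E.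

End Probability.

Section Newsvendor.
Context {R : realType}.

Definition argmin (Q : set R) (f : R -> R) : set R :=
  [set q | Q q /\ forall q', Q q' -> f q <= f q'].

Definition cost (D : R -> probability R R) (mu b h q : R) : R :=
  fine ('E_(D mu)[(fun x : R =>
    b * Num.max 0 (x - q) + h * Num.max 0 (q - x))%R])%E.

(* Periods are numbered 1, ..., T: the ordinal i : 'I_T stands for period i.+1.
   The neutral element 0 is the value at K = 0. *)
Definition demand_variation (T : nat) (mu : nat -> R) : R :=
  \big[Num.max/0]_(K < T)
   \big[Num.max/0]_(t : {ffun 'I_K.+1 -> 'I_T} |
       [forall i : 'I_K.+1, forall j : 'I_K.+1, (i < j)%N ==> (t i < t j)%N])
     \sum_(k < K)
        `|mu (t (lift ord0 k)).+1 - mu (t (widen_ord (leqnSn K) k)).+1| ^+ 2.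

Definition demand_class (T : nat) (mumin mumax v : R) : set (nat -> R) :=
  [set mu | (forall t, (1 <= t <= T)%N -> mumin <= mu t <= mumax) /\
            demand_variation T mu <= T%:R `^ v].

Definition history (d : nat -> R) (t : nat) : t.-1.-tuple R :=
  [tuple d i.+1 | i < t.-1].

(* Measurability is what gives the expected cost of a policy its meaning. *)
Definition is_policy (T : nat) (Q : set R)
    (p : forall t : nat, t.-1.-tuple R -> R) : Prop :=
  forall t, (1 <= t <= T)%N ->
    measurable_fun [set: t.-1.-tuple R] (p t) /\ forall x, Q (p t x).

Definition demand_process d (Omega : measurableType d)
    (P : probability Omega R) (T : nat) (D : R -> probability R R)
    (mu : nat -> R) (X : nat -> {RV P >-> R}) : Prop :=
  mutually_independent (fun i : 'I_T => X i.+1) /\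
  forall t, (1 <= t <= T)%N -> forall A : set R, measurable A ->
    distribution P (X t) A = D (mu t) A.

Definition regret d (Omega : measurableType d) (P : probability Omega R)
    (T : nat) (D : R -> probability R R) (b h : nat -> R)
    (p : forall t : nat, t.-1.-tuple R -> R) (mu qstar : nat -> R)
    (X : nat -> {RV P >-> R}) : \bar R :=
  ('E_P[(fun w => \sum_(1 <= t < T.+1)
     (cost D (mu t) (b t) (h t) (p t (history (fun s => X s w) t))
      - cost D (mu t) (b t) (h t) (qstar t)))%R])%E.

(* The expectation depends only on the joint law of the demands, so ranging
   over all probability spaces carrying them amounts to ranging over the
   demand sequences. *)
Definition worst_case_regret (T : nat) (Q : set R) (D : R -> probability R R)
    (mumin mumax : R) (b h : nat -> R) (v : R)
    (p : forall t : nat, t.-1.-tuple R -> R) : \bar R :=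
  ereal_sup [set r : \bar R | exists (mu qstar : nat -> R)
    (d : measure_display) (Omega : measurableType d)
    (P : probability Omega R) (X : nat -> {RV P >-> R}),
    [/\ demand_class T mumin mumax v mu,
        (forall t, (1 <= t <= T)%N ->
           argmin Q (cost D (mu t) (b t) (h t)) (qstar t)),
        demand_process T D mu X
      & r = regret T D b h p mu qstar X]].

End Newsvendor.

Section ShrinkingTimeWindow.
Context {R : realType}.

(* The exponent j - 1 is an integer, so that v_0 = 1 / (1 + log T); this is the
   value needed in v_{k-1} < 1 <= v_k when k = 1. *)
Definition window_exponent (T j : nat) : R :=
  (1 + (ln T%:R)^-1) ^ (j%:Z - 1) * (ln T%:R)^-1.

Definition window_size (T : nat) (kappa : R) (j : nat) : nat :=
  `|Num.ceil (kappa * T%:R `^ ((1 - window_exponent T j) / 2))|%N.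

(* T^(3/4) rounded to the nearest integer (a tie is impossible). *)
Definition burn_in (T : nat) : nat :=
  Num.truncn ((T%:R : R) `^ (3 / 4) + 1 / 2).

Definition mean_estimate (T : nat) (kappa mumin mumax : R) (d : nat -> R)
    (t j : nat) : R :=
  let n := window_size T kappa j in
  Num.max mumin (Num.min mumax (n%:R^-1 * \sum_(t - n <= s < t) d s)).

Definition switch_test (T : nat) (kappa gamma : R) (k : nat) (mumin mumax : R)
    (d : nat -> R) (i tif t : nat) : bool :=
  has (fun j => 2 * (gamma * Num.sqrt (ln T%:R) + Num.sqrt kappa)
                  * T%:R `^ ((3 + window_exponent T j) / 4)
                <= \sum_(tif <= s < t.+1)
                     `|mean_estimate T kappa mumin mumax d s i
                       - mean_estimate T kappa mumin mumax d s j|)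
      (index_iota i.+1 k.+1).

(* The pair (i, t_if) after the test of period burn_in T + m. *)
Fixpoint window_state (T : nat) (kappa gamma : R) (k : nat) (mumin mumax : R)
    (d : nat -> R) (m : nat) : nat * nat :=
  if m is m'.+1 then
    let: (i, tif) := window_state T kappa gamma k mumin mumax d m' in
    let t := (burn_in T + m)%N in
    if switch_test T kappa gamma k mumin mumax d i tif t
    then (i.+1, t) else (i, tif)
  else (1%N, (burn_in T).+1).

Definition window_index (T : nat) (kappa gamma : R) (k : nat) (mumin mumax : R)
    (d : nat -> R) (t : nat) : nat :=
  (window_state T kappa gamma k mumin mumax d (t - burn_in T)).1.

Definition is_shrinking_policy (T : nat) (Q : set R) (D : R -> probability R R)
    (mumin mumax : R) (b h : nat -> R) (kappa gamma : R) (k : nat)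
    (p : forall t : nat, t.-1.-tuple R -> R) : Prop :=
  is_policy T Q p /\
  forall (d : nat -> R) (t : nat), (burn_in T < t <= T)%N ->
    let i := window_index T kappa gamma k mumin mumax d t in
    argmin Q (cost D (mean_estimate T kappa mumin mumax d t i) (b t) (h t))
      (p t (history d t)).

End ShrinkingTimeWindow.

(* Main.v *)
Require Import Defs.
From HB Require Import structures.
From mathcomp Require Import all_boot all_order all_algebra.
From mathcomp Require Import all_classical all_reals all_analysis.
From mathcomp Require Import measurable_realfun.
From mathcomp Require Import ring lra zify.

Set Implicit Arguments.
Unset Strict Implicit.
Unset Printing Implicit Defensive.

Import Order.TTheory GRing.Theory Num.Theory.
Import numFieldNormedType.Exports.

Local Open Scope classical_set_scope.
Local Open Scope ring_scope.

(** Fix the demand means and write L for log T and V for the demand variation,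
    V <= T ^ v.  A window estimate errs by a noise part and a drift part.  By
    Hoeffding's inequality all noise parts of all windows j and periods are
    below gamma sqrt L T ^ ((v_j - 1) / 4) outside an event of probability
    at most 2 k T * T ^ (- 5 / 2) ([noise_event_le], [noise_tail_le]).  The
    drift part is deterministic: a lag-i difference splits into i subsequences,
    each of variation at most V, so that the squared lag-i differences sum to
    at most i V ([lag_sum_le_variation]), and the AM-GM inequality turns this
    into a bound on the cumulative drift of a window ([mean_drift_le]).

    Let j0 be the first window whose exponent reaches v.  On the good event
    every window from j0 on has cumulative error below half of its switching
    threshold ([cumulative_error_lt]).  Hence the policy never leaves window j0,
    and during each of its at most j0 phases the tests against j0 fail, so the
    cumulative error of the window in use is at most three half-thresholds of
    j0 ([phases_sum_le]).  An error e of the estimated mean costs at most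
    2 ell e of regret ([period_regret_le_error]).  The exponents grow by the
    factor 1 + 1 / L, so v_(j0) is at most v + 1 / L, which costs a factor
    e ^ (1 / 4) ([exists_matching_exponent]), and k <= 2 L ^ 2
    ([windows_count_le]); these factors give the rate.  The burn-in, the first
    period of each phase and the bad event are charged the largest regret of
    one period, max (bmax, hmax) Qmax ([period_regret_le]).

    The drift bound wants a window of size comparable to
    kappa T ^ ((1 - v_j) / 2), while the actual size is rounded up.  This is
    harmless when the real number is at least 2.  When it is below 2 for
    window j0, kappa is so small that the summand of the constant in
    delta / sqrt kappa pays for an error as large as the whole range of means,
    which is at most 8 delta ([small_window_bound]).  Both bounds need log T to
    be moderately large; otherwise T ^ (1 / 4) <= 6 L ^ (5 / 2) and the largest
    possible regret T max (bmax, hmax) Qmax is within the bound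
    ([trivial_bound]). *)

(** * Demand variation and lagged differences *)

Section Variation.
Context {R : realType}.
Implicit Types (mu : nat -> R) (T K i r : nat).

Lemma demand_variation_ge0 T mu : 0 <= demand_variation T mu.
Proof. exact: bigmax_ge_id. Qed.

Lemma increasing_sum_le_variation T mu K (u : nat -> nat) :
  (forall m n, (m < n)%N -> (u m < u n)%N) -> (u K < T)%N ->
  \sum_(m < K) `|mu (u m.+1).+1 - mu (u m).+1| ^+ 2 <= demand_variation T mu.
Proof.
move=> u_inc uKT; case: T uKT => // T uKT.
have u_ge m : (m <= u m)%N.
  by elim: m => // m IH; apply: leq_ltn_trans IH _; exact: u_inc.
have u_le m : (m <= K)%N -> (u m < T.+1)%N.
  rewrite leq_eqVlt => /predU1P[->//|mK].
  by rewrite (ltn_trans _ uKT)// u_inc.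
have KT : (K < T.+1)%N by exact: leq_ltn_trans (u_ge K) uKT.
pose t := [ffun i : 'I_K.+1 => inord (u i) : 'I_T.+1].
rewrite /demand_variation.
apply: le_trans (le_bigmax_cond _ _ (j := Ordinal KT) _) => //=.
apply: le_trans (le_bigmax_cond _ _ (j := t) _) => //=.
  rewrite le_eqVlt; apply/orP; left; apply/eqP; apply: eq_bigr => m _.
  by rewrite !ffunE /= !inordK ?u_le// /bump /= ?add1n// ltnW.
apply/forallP => m; apply/forallP => n; apply/implyP => mn.
by rewrite !ffunE !inordK ?u_le ?u_inc// -ltnS.
Qed.

(** The periods congruent to [r] modulo [i] form one increasing sequence. *)
Lemma residue_sum_le_variation T mu i r M :
  (0 < i)%N -> (r < i)%N ->
  \sum_(m < M | (r + m * i < T - i)%N)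
    `|mu (r + m * i + i).+1 - mu (r + m * i).+1| ^+ 2
  <= demand_variation T mu.
Proof.
move=> i0 ri; elim: M => [|M IH]; first by rewrite big_ord0 demand_variation_ge0.
(* If the last index is out of range, it contributes nothing; if it is in
   range, all the smaller ones are too and the condition can be dropped. *)
have [last_in|last_out] := ltnP (r + M * i)%N (T - i)%N; last first.
  rewrite big_mkcond big_ord_recr /= ltnNge last_out /= addr0.
  by rewrite -big_mkcond.
rewrite (eq_bigl xpredT) => [|m]; last first.
  apply/idP; apply: leq_ltn_trans last_in.
  by rewrite leq_add2l leq_mul2r -ltnS ltn_ord orbT.
rewrite (eq_bigr (fun m : 'I_M.+1 =>
   `|mu (r + m.+1 * i).+1 - mu (r + m * i).+1| ^+ 2)) => [|m _]; last first.
  by rewrite mulSn (addnC i) addnA.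
apply: (@increasing_sum_le_variation T mu M.+1 (fun m => r + m * i)%N).
  by move=> m n mn; rewrite ltn_add2l ltn_pmul2r.
by move: last_in; lia.
Qed.

Lemma sum_by_residue (F : nat -> R) i M :
  \sum_(s < M * i) F s = \sum_(m < M) \sum_(r < i) F (m * i + r)%N.
Proof.
elim: M => [|M IH]; first by rewrite mul0n !big_ord0.
rewrite big_ord_recr /= -IH mulSn addnC big_split_ord /=; congr +%R.
Qed.

Lemma lag_sum_le_variation T mu i : (0 < i)%N ->
  \sum_(s < T - i) `|mu (s + i).+1 - mu s.+1| ^+ 2
  <= i%:R * demand_variation T mu.
Proof.
move=> i0; set N := (T - i)%N.
(* Extending the summands by zero lets the sum run over [N] full blocks of
   length [i], which are then regrouped by residue. *)
pose g s := if (s < N)%N then `|mu (s + i).+1 - mu s.+1| ^+ 2 else 0.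
have g0 s : 0 <= g s by rewrite /g; case: ifP => // _; rewrite exprn_ge0.
apply: (@le_trans _ _ (\sum_(s < N * i) g s)).
  rewrite (eq_bigr (fun s : 'I_N => g s)) => [|s _]; last by rewrite /g ltn_ord.
  have NN : (N <= N * i)%N by rewrite leq_pmulr.
  rewrite -!(big_mkord xpredT) [leRHS](big_cat_nat (n := N)) //=.
  by rewrite lerDl sumr_ge0.
rewrite sum_by_residue exchange_big /=.
rewrite mulr_natl -[X in _ *+ X]card_ord -sumr_const.
apply: ler_sum => r _.
apply: le_trans (residue_sum_le_variation T mu N i0 (ltn_ord r)).
rewrite [leRHS]big_mkcond /=; apply: ler_sum => m _.
by rewrite /g addnC.
Qed.

End Variation.

(** * Errors of the window estimates *)

Section Windows.
Context {R : realType}.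
Implicit Types (mu d : nat -> R) (T B n t : nat).

Lemma window_sumE (f : nat -> R) n t : (n <= t)%N ->
  \sum_(t - n <= s < t) f s = \sum_(i < n) f (t - i.+1)%N.
Proof.
move=> nt; rewrite big_nat_rev /= -{1}[(t - n)%N]add0n big_addn.
rewrite subKn// big_mkord; apply: eq_bigr => i _; congr f.
by have := ltn_ord i; lia.
Qed.

Lemma shifted_squares_le_variation T B mu i : (0 < i)%N -> (i <= B)%N ->
  \sum_(B.+1 <= t < T.+1) `|mu (t - i)%N - mu t| ^+ 2
  <= i%:R * demand_variation T mu.
Proof.
move=> i0 iB; apply: le_trans (lag_sum_le_variation T mu i0).
have [TB|BT] := leqP T B.
  by rewrite big_geq// sumr_ge0// => s _; rewrite exprn_ge0.
apply: (@le_trans _ _ (\sum_(i.+1 <= t < T.+1) `|mu (t - i)%N - mu t| ^+ 2)).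
  rewrite [leRHS](big_cat_nat (n := B.+1)) //= ?lerDr ?sumr_ge0//; last by lia.
rewrite -{1}[i.+1]add0n big_addn subSS big_mkord.
apply: ler_sum => s _; rewrite distrC.
by rewrite (_ : s + i.+1 - i = s.+1)%N ?addnS//; lia.
Qed.

(** The drift is an average of lagged differences, and the lags 1, ..., n
    average to (n + 1) / 2.  The parameter [c] is the typical size of a
    difference, to be optimized. *)
Lemma mean_drift_le T B mu n (c : R) : (0 < n)%N -> (n <= B)%N -> 0 < c ->
  \sum_(B.+1 <= t < T.+1) `|n%:R^-1 * (\sum_(i < n) mu (t - i.+1)%N) - mu t|
  <= (c * T%:R + demand_variation T mu * (n.+1%:R / 2) / c) / 2.
Proof.
move=> n0 nB c0; have n0' : 0 < n%:R :> R by rewrite ltr0n.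
set V := demand_variation T mu.
have V0 : 0 <= V by exact: demand_variation_ge0.
(* Linearizing the square root by AM-GM at [c] avoids Cauchy-Schwarz. *)
have amgm (x : R) : 0 <= x -> x <= (c + x ^+ 2 / c) / 2.
  move=> x0; rewrite -subr_ge0.
  have -> : (c + x ^+ 2 / c) / 2 - x = (x - c) ^+ 2 / (2 * c).
    by field; rewrite gt_eqF.
  by rewrite divr_ge0 ?exprn_even_ge0// mulr_ge0// ltW.
have pointwise t : `|n%:R^-1 * (\sum_(i < n) mu (t - i.+1)%N) - mu t| <=
    n%:R^-1 * \sum_(i < n) (c + `|mu (t - i.+1)%N - mu t| ^+ 2 / c) / 2.
  have -> : n%:R^-1 * (\sum_(i < n) mu (t - i.+1)%N) - mu t =
      n%:R^-1 * \sum_(i < n) (mu (t - i.+1)%N - mu t).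
    rewrite big_split /= sumr_const card_ord -[(- mu t) *+ n]mulr_natl.
    by rewrite mulrDr mulrA mulVf ?gt_eqF// mul1r.
  rewrite normrM ger0_norm ?invr_ge0 ?ler0n// ler_pM2l ?invr_gt0//.
  apply: le_trans (ler_norm_sum _ _ _) _.
  by apply: ler_sum => i _; exact: amgm.
apply: le_trans (ler_sum _ (fun t _ => pointwise t)) _.
rewrite -mulr_sumr exchange_big /= ler_pdivrMl//.
apply: (@le_trans _ _ (\sum_(i < n) (c * T%:R + i.+1%:R * V / c) / 2)).
  apply: ler_sum => i _; rewrite -mulr_suml ler_pM2r// big_split /=.
  rewrite sumr_const_nat -[_ *+ _]mulr_natr lerD ?ler_pM2l//.
    by rewrite ler_nat subSS leq_subr.
  rewrite -mulr_suml ler_pM2r ?invr_gt0//.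
  by apply: shifted_squares_le_variation => //; apply: leq_trans (ltn_ord i) nB.
rewrite -mulr_suml big_split /= sumr_const card_ord -mulr_suml -mulr_suml.
have -> : \sum_(i < n) i.+1%:R = n%:R * n.+1%:R / 2 :> R.
  elim: (n) => [|m IH]; first by rewrite big_ord0 !mul0r.
  by rewrite big_ord_recr /= IH -[m.+2]addn1 -[m.+1]addn1 !natrD; field.
rewrite -mulr_natl le_eqVlt; apply/orP; left; apply/eqP.
by field; rewrite gt_eqF.
Qed.

Lemma clip_dist_le (mumin mumax x m : R) : mumin <= m <= mumax ->
  `|Num.max mumin (Num.min mumax x) - m| <= `|x - m|.
Proof.
move=> /andP[m1 m2]; rewrite /Num.max /Num.min.
have [x1|x1] := ltP mumax x; have [x2|x2] := ltP mumin _ => //.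
- by rewrite !ger0_norm; lra.
- by rewrite ger0_norm ?[leRHS]ger0_norm; lra.
- by rewrite !ler0_norm; lra.
Qed.

Lemma mean_estimate_in T kappa (mumin mumax : R) d t j : mumin <= mumax ->
  mumin <= mean_estimate T kappa mumin mumax d t j <= mumax.
Proof.
by move=> m12; rewrite /mean_estimate le_max lexx /= ge_max m12 /= ge_min lexx.
Qed.

(** The error of an estimate splits into noise, controlled by concentration,
    and drift, controlled by the demand variation. *)
Lemma mean_estimate_error_le T kappa (mumin mumax : R) mu d t j :
  let n := window_size T kappa j in
  (0 < n)%N -> (n <= t)%N -> mumin <= mu t <= mumax ->
  `|mean_estimate T kappa mumin mumax d t j - mu t| <=
    `|n%:R^-1 * \sum_(i < n) (d (t - i.+1)%N - mu (t - i.+1)%N)| +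
    `|n%:R^-1 * (\sum_(i < n) mu (t - i.+1)%N) - mu t|.
Proof.
move=> n n0 nt mut; rewrite /mean_estimate -/n window_sumE//.
apply: le_trans (clip_dist_le _ mut) _; apply: le_trans (ler_normD _ _).
by rewrite big_split sumrN /= mulrBr addrA subrK.
Qed.

End Windows.

(** * The phases of the policy *)

Section Phases.
Context {R : realType}.
Variables (T k : nat) (kappa gamma mumin mumax : R) (d : nat -> R).

Let B := burn_in (R := R) T.
Let est s j := mean_estimate T kappa mumin mumax d s j.
Let state := window_state T kappa gamma k mumin mumax d.
Let index := window_index T kappa gamma k mumin mumax d.
Let half_threshold j : R := (gamma * Num.sqrt (ln T%:R) + Num.sqrt kappa)
  * T%:R `^ ((3 + window_exponent T j) / 4).

(** If the cumulative error of every window from [j0] on stays below half of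
    its threshold, the triangle inequality makes every test passed at [j0]
    fail, so the index never exceeds [j0] and there are at most [j0] phases.
    During a phase the tests against [j0] fail, which bounds the cumulative
    error of the current window by three half-thresholds of [j0].  A period
    at which the policy switches is tested only with the previous index; the
    summand [W] pays for it. *)
Lemma phases_sum_le (mu r : nat -> R) (a W : R) j0 :
  (0 < j0 <= k)%N -> 0 <= a -> 0 <= W -> 0 <= half_threshold j0 ->
  (forall j, (j0 <= j <= k)%N -> half_threshold j0 <= half_threshold j) ->
  (forall j tif t, (j0 <= j <= k)%N -> (B < tif)%N -> (tif <= t <= T)%N ->
     \sum_(tif <= s < t.+1) `|est s j - mu s| < half_threshold j) ->
  (forall s, (B < s <= T)%N -> r s <= W) ->
  (forall s, (B < s <= T)%N -> r s <= a * `|est s (index s) - mu s|) ->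
  \sum_(B.+1 <= s < T.+1) r s <= j0%:R * (W + a * (3 * half_threshold j0)).
Proof.
move=> /andP[j0_gt0 j0k] a0 W0 thr_ge0 thr_mono err_small rW r_err.
set Z := W + _.
have ahalf0 : 0 <= a * (3 * half_threshold j0).
  by apply: mulr_ge0 => //; exact: mulr_ge0.
have Z0 : 0 <= Z by exact: addr_ge0.
have [TB|BT] := leqP T B; first by rewrite big_geq// mulr_ge0.
have triangle i j tif t : \sum_(tif <= s < t.+1) `|est s i - mu s| <=
    \sum_(tif <= s < t.+1) `|est s i - est s j| +
    \sum_(tif <= s < t.+1) `|est s j - mu s|.
  by rewrite -big_split; apply: ler_sum => s _; exact: ler_distD.
(* Completed phases, the current phase, and the index in use during it. *)
have inv m : (B + m <= T)%N -> let: (i, tif) := state m in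
  [/\ (0 < i <= j0)%N, (B < tif <= (B + m).+1)%N,
      \sum_(B.+1 <= s < tif) r s <= (i.-1)%:R * Z,
      \sum_(tif <= s < (B + m).+1) r s <= Z &
      forall s, (tif <= s <= B + m)%N -> index s = i].
  elim: m => [|m IH] mT.
    by rewrite addn0; split=> //; rewrite ?big_geq ?mul0r ?ltnSn// => s /andP[]; lia.
  rewrite addnS in mT *; have := IH (ltnW mT).
  rewrite {2}/state /= -/(state m); case def_im: (state m) => [i tif].
  move=> [/andP[i0 ij0] /andP[Btif tif_le] past current idx].
  have index_t : index (B + m).+1 = (state m.+1).1.
    by rewrite /index /window_index -/B -addnS addKn.
  have tT : (B < (B + m).+1 <= T)%N by rewrite mT; lia.
  rewrite addnS; set t := (B + m).+1 in mT index_t tT *.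
  have state_eq : state m.+1 =
      if switch_test T kappa gamma k mumin mumax d i tif t
      then (i.+1, t) else (i, tif).
    by rewrite {1}/state /= -/(state m) def_im -/B addnS.
  move: index_t; rewrite state_eq.
  case: ifPn => [/hasP[j]|/hasPn no_switch].
    rewrite mem_index_iota ltnS => /andP[ij jk] jtest /= index_t.
    have {ij0} ij0 : (i < j0)%N.
      rewrite ltn_neqAle ij0 andbT; apply/eqP => eq_i; subst i.
      have j_in : (j0 <= j <= k)%N by rewrite jk ltnW.
      have tif_t : (tif <= t <= T)%N by rewrite tif_le.
      move: jtest; rewrite leNgt => /negP; apply.
      rewrite -mulrA -/(half_threshold j).
      apply: (@le_lt_trans _ _ (\sum_(tif <= s < t.+1) `|est s j0 - mu s| +
          \sum_(tif <= s < t.+1) `|est s j - mu s|)).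
        rewrite -big_split; apply: ler_sum => s _ /=.
        by rewrite (distrC (est s j)) ler_distD.
      have e1 := err_small j _ _ j_in Btif tif_t.
      have e0 := err_small j0 _ _ (introT andP (conj (leqnn _) j0k)) Btif tif_t.
      by have := thr_mono _ j_in; lra.
    split.
    - by rewrite ij0.
    - by rewrite leqnSn andbT; case/andP: tT.
    - rewrite (big_cat_nat (n := tif)) //=.
      by rewrite -[i in leRHS]prednK// -natr1 mulrDl mul1r lerD.
    - rewrite big_nat1; apply: le_trans (rW _ tT) _.
      by rewrite lerDl.
    - by move=> s; rewrite -eqn_leq => /eqP <-.
  move=> /= index_t; have idx' s : (tif <= s <= t)%N -> index s = i.
    move=> /andP[s1]; rewrite leq_eqVlt => /predU1P[->//|s2].
    by apply: idx; rewrite s1.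
  split=> //.
  - by rewrite i0.
  - by rewrite Btif leqW.
  - apply: (@le_trans _ _ (\sum_(tif <= s < t.+1) a * `|est s i - mu s|)).
      rewrite big_nat [leRHS]big_nat; apply: ler_sum => s /andP[s1 s2].
      by rewrite -(idx' s) ?s1//; apply: r_err; lia.
    rewrite -mulr_sumr; apply: le_trans (_ : a * (3 * half_threshold j0) <= _).
      rewrite ler_wpM2l//.
      have tif_t : (tif <= t <= T)%N by rewrite tif_le.
      have e0 := err_small j0 _ _ (introT andP (conj (leqnn _) j0k)) Btif tif_t.
      have [ij|] := ltnP i j0; last first.
        move=> ij; have -> : i = j0 by lia.
        by lra.
      have := no_switch j0; rewrite mem_index_iota ltnS ij j0k => /(_ isT).
      rewrite -ltNge -mulrA -/(half_threshold j0) => test.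
      by apply: le_trans (triangle i j0 tif t) _; lra.
    by rewrite lerDr.
have := inv (T - B)%N; rewrite subnKC ?leqnn => [/(_ isT)|]; last exact: ltnW.
case: (state _) => i tif [/andP[i0 ij0] /andP[Btif tifT] past current _].
rewrite (big_cat_nat (n := tif)) //=.
apply: (@le_trans _ _ (i%:R * Z)); last by rewrite ler_wpM2r// ler_nat.
by rewrite -[i in leRHS]prednK// -natr1 mulrDl mul1r lerD.
Qed.

End Phases.

(** * Moments and the newsvendor cost *)

Section Probability.
Context {R : realType}.

(** The integral of a nonnegative function is a supremum over the simple
    functions below it, hence monotone even among functions that are not known
    to be measurable, such as a regret. *)
Lemma ge0_le_integral_nonmeasurable d (Omega : measurableType d)
    (P : {measure set Omega -> \bar R}) (f g : Omega -> \bar R) :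
  (forall w, 0 <= f w)%E -> (forall w, f w <= g w)%E ->
  (\int[P]_w f w <= \int[P]_w g w)%E.
Proof.
move=> f0 fg; rewrite !ge0_integralTE//; last first.
  by move=> w; apply: le_trans (f0 w) (fg w).
apply: ereal_sup_le => _ [h hf <-]; exists h => // w.
exact: le_trans (hf w) (fg w).
Qed.

(** |x| / K is at most the number of integers n with n K < |x|, and the
    probability that n K < |x| is at most 2 exp (- n ^ 2) <= 2 * 2 ^ (- n);
    the constant 4 is the sum of this geometric series. *)
Lemma subgaussian_first_moment (P : probability R R) (K : R) : 0 < K ->
  (forall x : R, 0 <= x ->
    (P [set w : R | x < `|w|]%R <= (2 * expR (- (x ^+ 2 / K ^+ 2)))%:E)%E) ->
  (\int[P]_x `|x|%:E <= (4 * K)%:E)%E.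
Proof.
move=> K0 tail.
have K_ge0 := ltW K0; pose A (n : nat) := [set x : R | n%:R * K < `|x|].
have mA n : measurable (A n).
  rewrite (_ : A n = [set: R] `&` (fun y : R => `|y|) @^-1` `]n%:R * K, +oo[).
    exact: normr_measurable.
  by rewrite setTI; apply/seteqP; split=> x /=; rewrite in_itv/= andbT.
have PA n : (P (A n) <= (4 / (2 ^ (n + 1))%:R)%:E)%E.
  apply: le_trans (tail _ _) _; first by rewrite mulr_ge0.
  rewrite lee_fin addn1 expnS natrM natrX.
  rewrite (_ : 4 / _ = 2 * (2^-1) ^+ n); last first.
    by rewrite exprVn; field; rewrite expf_neq0.
  rewrite ler_pM2l// exprMn mulfK ?gt_eqF ?exprn_gt0//.
  apply: (@le_trans _ _ (expR (-1) ^+ n)); last first.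
    rewrite lerXn2r ?nnegrE ?expR_ge0 ?invr_ge0// expRN.
    rewrite lef_pV2 ?posrE ?expR_gt0//.
    exact: expR_ge1Dx.
  rewrite -expRM_natl ler_expR mulrN1 lerN2 -natrX ler_nat.
  by case: n => // n; rewrite expnS leq_pmulr// muln1.
have pointwise (x : R) :
    (`|x|%:E <= \sum_(0 <= n <oo) (K * \1_(A n) x)%:E)%E.
  have term_ge0 n : (0 <= (K * \1_(A n) x)%:E)%E.
    by rewrite lee_fin mulr_ge0.
  pose N := `|Num.ceil (`|x| / K)|%N.
  rewrite (nneseries_split 0%N N)//; apply: lee_paddr.
    exact: nneseries_ge0.
  rewrite add0n sumEFin lee_fin.
  rewrite (eq_big_nat _ _ (F2 := fun=> K)); last first.
    move=> n /andP[_ nN]; rewrite indicE mem_set ?mulr1// /A /=.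
    rewrite -ltr_pdivlMr//.
    have : (n%:Z < Num.ceil (`|x| / K)).
      have : 0 <= Num.ceil (`|x| / K).
        by rewrite ceil_ge0 (lt_le_trans (ltrN10 R))// divr_ge0.
      by move: nN; rewrite /N; lia.
    by rewrite ceil_gt_int.
  rewrite sumr_const_nat subn0 -[_ *+ _]mulr_natl -ler_pdivrMr//.
  apply: le_trans (ceil_ge _) _.
  by rewrite pmulrn ler_int abszE ler_norm.
apply: le_trans (ge0_le_integral_nonmeasurable _ _ pointwise) _.
  by move=> x; rewrite lee_fin.
rewrite integral_nneseries//; last 2 first.
- move=> n; apply/measurable_EFinP.
  by apply: measurable_funM => //; exact: measurable_indic.
- by move=> n x _; rewrite lee_fin mulr_ge0.
apply: (@le_trans _ _
  (\sum_(0 <= n <oo) ((4 * K) / (2 ^ (n + 1))%:R)%:E)%E).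
  apply: lee_nneseries => n _.
    by move=> _; apply: integral_ge0 => x _; rewrite lee_fin mulr_ge0.
  under eq_integral do rewrite EFinM.
  rewrite ge0_integralZl//; last first.
    by apply/measurable_EFinP; exact: measurable_indic.
  rewrite integral_indic// setIT.
  rewrite (_ : 4 * K / _ = K * (4 / (2 ^ (n + 1))%:R)); last by ring.
  by rewrite EFinM; apply: lee_wpmul2l; [rewrite lee_fin|exact: PA].
have /cvg_lim -> // := @cvg_geometric_eseries_half R (4 * K) 0.
by rewrite expr0 divr1.
Qed.

Lemma norm_mean_le_first_moment (P : probability R R) (m : R) :
  ('E_P[fun x : R => x] = m%:E)%E -> (`|m|%:E <= \int[P]_x `|x|%:E)%E.
Proof.
rewrite unlock => mE; rewrite -abse_EFin -mE.
by apply: le_abse_integral => //; apply/measurable_EFinP.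
Qed.

Lemma first_moment_le_subgaussian_norm (P : probability R R) (K : R) :
  (subgaussian_norm P (fun x : R => x) < K%:E)%E ->
  (\int[P]_x `|x|%:E <= (4 * K)%:E)%E.
Proof.
move=> /ereal_inf_lt[_ [K' [K'0 tail] <-]] K'K.
apply: le_trans (subgaussian_first_moment K'0 tail) _.
by rewrite lee_fin ler_pM2l// -lee_fin ltW.
Qed.

Lemma subgaussian_norm_ge0 d (Omega : measurableType d)
    (P : probability Omega R) (X : Omega -> R) :
  (0 <= subgaussian_norm P X)%E.
Proof.
by apply: le_ereal_inf_tmp => _ [K [K0 _] <-]; rewrite lee_fin ltW.
Qed.

Section Cost.
Variables (D : R -> probability R R) (mu : R).
Hypothesis moment : (\int[D mu]_x `|x|%:E < +oo)%E.
Variables (b h M : R).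
Hypotheses (hb : 0 <= b <= M) (hh : 0 <= h <= M).

Let loss (q x : R) := b * Num.max 0 (x - q) + h * Num.max 0 (q - x).

Let loss_ge0 q x : 0 <= loss q x.
Proof.
case/andP: hb => b0 _; case/andP: hh => h0 _.
by rewrite addr_ge0// mulr_ge0// le_max lexx.
Qed.

Let loss_le q x : loss q x <= M * (`|x| + `|q|).
Proof.
case/andP: hb => b0 bM; case/andP: hh => h0 hM.
have [x0 q0] : 0 <= `|x| /\ 0 <= `|q| by [].
have xq : x - q <= `|x| + `|q|.
  by apply: le_trans (ler_normB _ _); exact: ler_norm.
have qx : q - x <= `|x| + `|q|.
  by rewrite [leRHS]addrC; apply: le_trans (ler_normB _ _); exact: ler_norm.
rewrite /loss /Num.max; have [h1|h1] := ltP 0 (x - q);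
  have [h2|h2] := ltP 0 (q - x); nra.
Qed.

Let loss_lipschitz q q' x : loss q x <= loss q' x + M * `|q - q'|.
Proof.
case/andP: hb => b0 bM; case/andP: hh => h0 hM.
have M0 : 0 <= M by exact: le_trans b0 bM.
have n1 := ler_norm (q - q'); have n2 : q' - q <= `|q - q'|.
  by rewrite distrC ler_norm.
have n0 := normr_ge0 (q - q').
by rewrite /loss /Num.max; have [h1|h1] := ltP 0 (x - q);
  have [h2|h2] := ltP 0 (q - x); have [h3|h3] := ltP 0 (x - q');
  have [h4|h4] := ltP 0 (q' - x); nra.
Qed.

Let measurable_loss q : measurable_fun [set: R] (fun x => (loss q x)%:E).
Proof.
apply/measurable_EFinP; apply: measurable_funD; apply: measurable_funM => //.
  by apply: measurable_maxr => //; exact: measurable_funB.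
by apply: measurable_maxr => //; exact: measurable_funB.
Qed.

Let cost_fin q : (\int[D mu]_x (loss q x)%:E)%E \is a fin_num.
Proof.
case/andP: hb => b0 bM; have M0 : 0 <= M by exact: le_trans b0 bM.
rewrite ge0_fin_numE; last by apply: integral_ge0 => x _; rewrite lee_fin.
apply: (@le_lt_trans _ _ (\int[D mu]_x (M%:E * (`|x|%:E + `|q|%:E)))%E).
  apply: ge0_le_integral_nonmeasurable => x; rewrite lee_fin//.
have mnorm : measurable_fun [set: R] (fun x : R => `|x|%:E).
  by apply/measurable_EFinP; exact: normr_measurable.
rewrite ge0_integralZl//; last 2 first.
- by apply: emeasurable_funD.
- by move=> x _; rewrite -EFinD lee_fin addr_ge0.
rewrite ge0_integralD//.
rewrite lte_mul_pinfty// lte_add_pinfty//.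
rewrite integral_cst; last exact: measurableT.
by rewrite [X in (_ * X)%E](probability_setT (D mu)) mule1 ltry.
Qed.

Lemma cost_lipschitz_in_order q q' :
  cost D mu b h q - cost D mu b h q' <= M * `|q - q'|.
Proof.
case/andP: hb => b0 bM; have M0 : 0 <= M by exact: le_trans b0 bM.
rewrite /cost unlock -/(loss q) -/(loss q') lerBlDl.
rewrite -lee_fin EFinD !fineK ?cost_fin//.
apply: (@le_trans _ _ (\int[D mu]_x ((loss q' x)%:E + (M * `|q - q'|)%:E))%E).
  apply: ge0_le_integral_nonmeasurable => x; rewrite lee_fin.
    exact: loss_ge0.
  exact: loss_lipschitz.
rewrite ge0_integralD//; last 2 first.
- by move=> x _; rewrite lee_fin.
- by move=> x _; rewrite lee_fin mulr_ge0.
rewrite integral_cst; last exact: measurableT.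
by rewrite [X in (_ * X)%E](probability_setT (D mu)) mule1.
Qed.

End Cost.

End Probability.

(** * Concentration of the noise *)

Section Concentration.
Context {R : realType}.

(** The bound on [f] is the form in which a union bound uses that [f] is at most
    [a] off the bad events and at most [c] on them. *)
Lemma expectation_le_union d (Omega : measurableType d)
    (P : probability Omega R) (I : finType) (bad : I -> set Omega)
    (f : Omega -> R) (a c q : R) :
  (forall i, measurable (bad i)) -> 0 <= a -> 0 <= c ->
  (forall i, (P (bad i) <= q%:E)%E) ->
  (forall w, 0 <= f w) ->
  (forall w, f w <= a + c * \sum_i \1_(bad i) w) ->
  ('E_P[f] <= (a + c * (#|I|%:R * q))%:E)%E.
Proof.
move=> mbad a0 c0 badq f0 fle; rewrite unlock.
apply: (@le_trans _ _ (\int[P]_w (a%:E + c%:E * \sum_i (\1_(bad i) w)%:E))%E).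
  apply: ge0_le_integral_nonmeasurable => w; rewrite ?lee_fin//.
  by rewrite sumEFin -EFinM -EFinD lee_fin.
have ind0 i w : (0 <= (\1_(bad i) w : R)%:E)%E by rewrite lee_fin.
have mind i : measurable_fun [set: Omega] (fun w => (\1_(bad i) w : R)%:E).
  by apply/measurable_EFinP; exact: measurable_indic.
have sum0 w : (0 <= \sum_i (\1_(bad i) w : R)%:E)%E by exact: sume_ge0.
have msum : measurable_fun [set: Omega] (fun w => \sum_i (\1_(bad i) w : R)%:E)%E.
  exact: emeasurable_sum.
rewrite ge0_integralD//; last 2 first.
- by move=> w _; rewrite mule_ge0.
- by apply: emeasurable_funM.
rewrite ge0_integralZl// ge0_integral_sum//.
rewrite EFinD; apply: leeD.
  rewrite integral_cst; last exact: measurableT.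
  by rewrite [X in (_ * X)%E]probability_setT mule1.
rewrite EFinM lee_wpmul2l ?lee_fin//.
apply: (@le_trans _ _ (\sum_(i : I) q%:E)%E).
  by apply: lee_sum => i _; rewrite integral_indic ?setIT; [exact: badq| |exact: mbad].
by rewrite sumEFin sumr_const -[_ *+ _]mulr_natl lee_fin.
Qed.

Section Process.
Context d (Omega : measurableType d) (P : probability Omega R).
Variables (T : nat) (D : R -> probability R R) (mu : nat -> R).
Variable X : nat -> {RV P >-> R}.
Hypothesis process : demand_process T D mu X.
Hypothesis moment : forall t, (1 <= t <= T)%N ->
  (\int[D (mu t)]_x `|x|%:E < +oo)%E.
Hypothesis mean : forall t, (1 <= t <= T)%N ->
  ('E_(D (mu t))[fun x : R => x] = (mu t)%:E)%E.
Variables (delta_eps rho : R).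
Hypothesis delta_eps0 : 0 < delta_eps.
Hypothesis noise_norm : forall t, (1 <= t <= T)%N ->
  (subgaussian_norm (D (mu t)) (fun x : R => x - mu t)%R <= delta_eps%:E)%E.
Hypothesis hoeffding : hoeffding_constant rho.

Fact measurable_centered (Y : {RV P >-> R}) (m : R) :
  measurable_fun [set: Omega] (fun w => Y w - m).
Proof. exact: measurable_funB. Qed.

Definition centered (Y : {RV P >-> R}) (m : R) : {RV P >-> R} :=
  mfun_Sub (mem_set (measurable_centered Y m)).

Lemma expectation_centered t : (1 <= t <= T)%N ->
  ('E_P[centered (X t) (mu t)] = 0)%E.
Proof.
move=> tT; pose f (x : R) : \bar R := (x - mu t)%:E.
have mf : measurable_fun [set: R] f.
  by apply/measurable_EFinP; exact: measurable_funB.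
have law (g : R -> \bar R) :
    (\int[distribution P (X t)]_x g x = \int[D (mu t)]_x g x)%E.
  by apply: eq_measure_integral => A mA _; case: process => _; exact.
have id_int : (D (mu t)).-integrable [set: R] (fun x : R => x%:E).
  by apply/integrableP; split; [apply/measurable_EFinP|exact: moment].
have cst_int : (D (mu t)).-integrable [set: R] (fun=> (mu t)%:E).
  exact: finite_measure_integrable_cst.
have f_int : (D (mu t)).-integrable [set: R] f.
  rewrite (_ : f = ((fun x : R => x%:E) \- (fun=> (mu t)%:E))%E); last first.
    by apply/funext => x; rewrite /f EFinB.
  exact: integrableB.
rewrite unlock; transitivity (\int[P]_w (f \o X t) w)%E; first by [].
rewrite -integral_distribution//; last first.
  apply/integrableP; split; first exact: measurableT_comp.
  have /integrableP[_] := f_int; rewrite -law ge0_integral_distribution//.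
  exact: measurableT_comp.
rewrite law /f; under eq_integral do rewrite EFinB.
rewrite integralB//.
have := mean tT; rewrite unlock => ->.
rewrite integral_cst; last exact: measurableT.
by rewrite [X in (_ * X)%E](probability_setT (D (mu t))) mule1 subee.
Qed.

Lemma subgaussian_norm_centered t : (1 <= t <= T)%N ->
  (subgaussian_norm P (centered (X t) (mu t)) <= delta_eps%:E)%E.
Proof.
move=> tT; apply: le_trans (noise_norm tT).
rewrite le_eqVlt; apply/orP; left; apply/eqP; congr ereal_inf.
suff tail x : P [set w | x < `|X t w - mu t|]%R =
    D (mu t) [set y | x < `|y - mu t|]%R.
  by apply/seteqP; split=> _ [K [K0 hK] <-]; exists K => //; split=> // x x0;
    [rewrite -tail|have := hK _ x0; rewrite -tail]; do ?exact: hK.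
have [_ /(_ _ tT) <-] := process; first by [].
rewrite (_ : [set y | _] = [set: R] `&` (fun y : R => `|y - mu t|) @^-1` `]x, +oo[).
  apply: (@measurableT_comp _ _ _ _ _ _ (@Num.norm R R)) => //.
  exact: measurable_funB.
by rewrite setTI; apply/seteqP; split=> y /=; rewrite in_itv/= andbT.
Qed.

(** A window is an injective selection of periods, with [past] mapping a lag to
    its period and [lag] mapping back; the Borel sets of the window are
    transported along [lag] and shifted by the means. *)
Lemma independent_window n t : (n < t <= T)%N ->
  mutually_independent
    (fun i : 'I_n => centered (X (t - i.+1)%N) (mu (t - i.+1)%N)).
Proof.
move=> /andP[nt tT] J A mA; have [indep _] := process.
case: n nt J A mA => [|n] nt J A mA.
  rewrite (_ : J = finset.set0); last by apply/finset.setP => -[].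
  rewrite big_set0 (_ : bigcap _ _ = [set: Omega]) ?probability_setT//.
  by apply/seteqP; split=> // w _ i /=; rewrite inE.
case: T tT indep => [|T'] tT indep; first by move: nt tT; lia.
pose past (i : 'I_n.+1) : 'I_T'.+1 := inord (t - i.+2).
have pastE i : (past i).+1 = (t - i.+1)%N.
  by rewrite inordK; have := ltn_ord i; lia.
pose lag (s : 'I_T'.+1) : 'I_n.+1 := inord (t - s.+2).
have pastK : cancel past lag.
  move=> i; apply: val_inj; rewrite /= inordK; have := pastE i;
  have := ltn_ord i; lia.
pose A' (s : 'I_T'.+1) := (fun y : R => y - mu s.+1) @^-1` A (lag s).
have mA' s : measurable (A' s).
  by rewrite -[A' s]setTI; apply: measurable_funB => //.
have := indep (past @: J) A' mA'.
rewrite big_imset /=; last by move=> i j _ _; exact: (can_inj pastK).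
have pre i : X (past i).+1 @^-1` A' (past i) =
    centered (X (t - i.+1)%N) (mu (t - i.+1)%N) @^-1` A i.
  by rewrite /A' pastK pastE; apply/seteqP; split.
under eq_bigr do rewrite pre.
move=> <-; congr (P _); apply/seteqP; split=> w /= hw.
  by move=> _ /imsetP[i iJ ->]; rewrite pre; exact: hw.
by move=> i iJ; rewrite -pre; apply: hw; exact: imset_f.
Qed.

Definition noise_event n t (x : R) : set Omega :=
  [set w | x <= `|n%:R^-1 *
    \sum_(i < n) (X (t - i.+1)%N w - mu (t - i.+1)%N)|].

Lemma measurable_noise_event n t x : measurable (noise_event n t x).
Proof.
rewrite /noise_event (_ : [set w | _] = [set: Omega] `&`
  (fun w => `|n%:R^-1 * \sum_(i < n) (X (t - i.+1)%N w - mu (t - i.+1)%N)|)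
     @^-1` `[x, +oo[).
  apply: (@measurableT_comp _ _ _ _ _ _ (@Num.norm R R)) => //.
  apply: measurable_funM => //; apply: measurable_sum => i.
  exact: measurable_centered.
by rewrite setTI; apply/seteqP; split=> w /=; rewrite in_itv/= andbT.
Qed.

Lemma noise_event_le n t x : (0 < n < t)%N -> (t <= T)%N -> 0 <= x ->
  (P (noise_event n t x)
     <= (2 * expR (- (rho * n%:R * x ^+ 2 / delta_eps ^+ 2)))%:E)%E.
Proof.
move=> /andP[n0 nt] tT x0; have [_ /(_ _ _ P n _ delta_eps x n0 delta_eps0 x0)] := hoeffding.
have inT (i : 'I_n) : (1 <= t - i.+1 <= T)%N by have := ltn_ord i; lia.
move=> /(_ _ (independent_window _)); apply; first by rewrite nt.
- by move=> i; exact: expectation_centered.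
- by move=> i; exact: subgaussian_norm_centered.
Qed.

End Process.

End Concentration.

(** * Window exponents and window sizes *)

Section Scales.
Context {R : realType}.
Implicit Types (T j k : nat).

Lemma powR_natE T (y : R) : (0 < T)%N -> T%:R `^ y = expR (y * ln T%:R).
Proof. by move=> T0; rewrite /powR pnatr_eq0 gtn_eqF. Qed.

Lemma expR_le_inv1B (x : R) : x < 1 -> expR x <= (1 - x)^-1.
Proof.
move=> x1; rewrite -[expR x]invrK -expRN lef_pV2 ?posrE ?expR_gt0 ?subr_gt0//.
exact: expR_ge1Dx.
Qed.

Lemma expR_le_pow (n : nat) (x : R) : x <= 4^-1 -> expR (n%:R * x) <= (4 / 3) ^+ n.
Proof.
move=> x4; rewrite expRM_natl lerXn2r ?nnegrE ?expR_ge0//.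
apply: le_trans (expR_le_inv1B _) _; first by lra.
by rewrite -div1r ler_pdivrMr; lra.
Qed.

Lemma expR1_le4 : expR 1 <= 4 :> R.
Proof.
have := @expR_le_pow 4 4^-1 (lexx _); rewrite mulfV// => /le_trans; apply.
by lra.
Qed.

Lemma ln_nat_ge T : (2 <= T)%N -> 3 / 5 <= ln T%:R :> R.
Proof.
move=> T2; have T0 : 0 < T%:R :> R by rewrite ltr0n; lia.
rewrite -[3 / 5]expRK ler_ln ?posrE ?expR_gt0//.
apply: (@le_trans _ _ 2); last by rewrite ler_nat.
have h1 : expR (3 / 20) <= 20 / 17 :> R.
  apply: le_trans (expR_le_inv1B _) _; first by lra.
  by rewrite -div1r ler_pdivrMr; lra.
have -> : 3 / 5 = 4%:R * (3 / 20) :> R by lra.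
rewrite expRM_natl; apply: (@le_trans _ _ ((20 / 17) ^+ 4)); last by lra.
by rewrite lerXn2r ?nnegrE ?expR_ge0//; lra.
Qed.

Lemma powR_half_integer (x : R) : 0 <= x -> x `^ (5 / 2) = x ^+ 2 * Num.sqrt x.
Proof.
move=> x0; have -> : 5 / 2 = 2%:R + 2^-1 :> R by lra.
rewrite powRD; last by apply/implyP => /eqP; lra.
by rewrite powR12_sqrt// powR_mulrn.
Qed.

(** Below 20, the exponential exp (L / 4) stays under 6 L ^ (5 / 2); this is
    checked on [3/5, 1], [1, 4], [4, 12] and [12, 20] at the right end point
    of exp and the left end point of the power. *)
Lemma ln_ge20 T : (2 <= T)%N ->
  6 * (ln T%:R : R) `^ (5 / 2) < T%:R `^ (1 / 4) -> 20 <= ln T%:R :> R.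
Proof.
move=> T2; rewrite powR_natE ?(ltnW T2)//; have := ln_nat_ge T2.
move: (ln _) => L L35; rewrite powR_half_integer; last by lra.
rewrite ltNge => /negP big; rewrite leNgt; apply/negP => L20; apply: big.
have L0 : 0 <= L by lra.
have exp_le (n : nat) : L / 4 <= n%:R * 4^-1 -> (0 < n)%N ->
    expR (1 / 4 * L) <= (4 / 3) ^+ n.
  move=> Ln n0; have -> : 1 / 4 * L = n%:R * (L / 4 / n%:R).
    by field; rewrite pnatr_eq0 -lt0n.
  by apply: expR_le_pow; rewrite ler_pdivrMr ?ltr0n// [leRHS]mulrC.
have [L1|L1] := ltP L 1.
  have s : 7 / 10 <= Num.sqrt L.
    have -> : 7 / 10 = Num.sqrt ((7 / 10) ^+ 2) :> R.
      by rewrite sqrtr_sqr ger0_norm//; lra.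
    by rewrite ler_wsqrtr//; lra.
  have := exp_le 1%N; rewrite mul1r => e1.
  by apply: le_trans (e1 _ _) _ => //; nra.
have s : 1 <= Num.sqrt L by rewrite -[leLHS]sqrtr1 ler_wsqrtr.
have L2 : L ^+ 2 <= L ^+ 2 * Num.sqrt L by rewrite ler_peMr// exprn_ge0.
apply: (@le_trans _ _ (6 * L ^+ 2)); last by rewrite ler_pM2l.
have [L4|L4] := leP L 4; [|have [L12|L12] := leP L 12].
- by apply: le_trans (exp_le 4%N _ _) _ => //; nra.
- by apply: le_trans (exp_le 12%N _ _) _ => //; nra.
- by apply: le_trans (exp_le 20%N _ _) _ => //; nra.
Qed.

Lemma window_exponentS T j :
  window_exponent T j.+1 = (1 + (ln T%:R)^-1) ^+ j * (ln T%:R)^-1 :> R.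
Proof.
rewrite /window_exponent (_ : j.+1%:Z - 1 = j%:Z)//.
by rewrite -addn1 PoszD addrK.
Qed.

Lemma window_exponent_mono T i j : (2 <= T)%N -> (0 < i <= j)%N ->
  window_exponent T i <= window_exponent T j :> R.
Proof.
move=> T2; case: i j => // i [//|j] /= ij; rewrite !window_exponentS.
have L0 : 0 < ln T%:R :> R by have := ln_nat_ge T2; lra.
by rewrite ler_pM2r ?invr_gt0// ler_weXn2l// lerDl invr_ge0 ltW.
Qed.

(** The exponents grow by a factor 1 + 1 / log T from 1 / log T, so they never
    skip an interval of length 1 / log T below 1; on the scale of powers of T
    this costs a constant factor. *)
Lemma exists_matching_exponent T k (v : R) :
  (2 <= T)%N -> (0 < k)%N -> 0 <= v <= 1 -> 1 <= window_exponent T k :> R ->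
  exists j, [/\ (0 < j <= k)%N, v <= window_exponent T j &
    T%:R `^ ((3 + window_exponent T j) / 4)
      <= expR (1 / 4) * T%:R `^ ((3 + v) / 4)].
Proof.
move=> T2 k0 /andP[v0 v1] vk.
have L0 : 0 < ln T%:R :> R by have := ln_nat_ge T2; lra.
pose ok j := (0 < j)%N && (v <= window_exponent T j).
have okk : ok k by rewrite /ok k0 (le_trans v1).
case: (ex_minnP (ex_intro ok k okk)) => j /andP[j0 vj] jmin.
exists j; split=> //; first by rewrite j0 jmin.
rewrite !powR_natE ?(ltnW T2)// -expRD ler_expR.
suff vjL : window_exponent T j <= v + (ln T%:R)^-1.
  move: vjL; rewrite -(ler_pM2r L0) mulrDl mulVf ?gt_eqF//.
  by lra.
case: j j0 vj jmin => // -[|j] _ vj jmin.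
  by rewrite window_exponentS expr0 mul1r lerDr.
have vj' : window_exponent T j.+1 < v.
  by rewrite ltNge; apply/negP => h; have := jmin j.+1; rewrite /ok h ltnn => /(_ isT).
rewrite window_exponentS exprSr mulrAC -window_exponentS mulrDr mulr1.
apply: lerD; first exact: ltW.
by rewrite ler_piMl ?invr_ge0 ?(ltW L0)// ltW// (lt_le_trans vj').
Qed.

(** Bernoulli's inequality gives 1 + (k - 2) / L <= (1 + 1 / L) ^ (k - 2) < L,
    and L ^ 2 - L + 2 <= 2 L ^ 2 because L >= 1. *)
Lemma windows_count_le T k : (2 <= T)%N -> 1 <= ln T%:R :> R -> (0 < k)%N ->
  window_exponent T k.-1 < (1 : R) -> k%:R <= 2 * ln T%:R ^+ 2 :> R.
Proof.
move=> T2 L1; case: k => // -[|k] _ /=; first by nra.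
rewrite window_exponentS => vk; set L := ln _ in L1 vk *.
have L0 : 0 < L by lra.
have bern m : 1 + m%:R / L <= (1 + L^-1) ^+ m.
  have Li : 0 < L^-1 by rewrite invr_gt0.
  elim: m => [|m IH]; first by rewrite mul0r addr0.
  rewrite exprS; apply: (@le_trans _ _ ((1 + L^-1) * (1 + m%:R / L))).
    have : 0 <= L^-1 * (m%:R / L) by rewrite mulr_ge0// ?divr_ge0// ltW.
    by rewrite -[m.+1]addn1 natrD; lra.
  by rewrite ler_pM2l// addr_gt0.
have : 1 + k%:R / L < L.
  apply: le_lt_trans (bern k) _; move: vk.
  by rewrite ltr_pdivrMr// mul1r.
rewrite -ltrBrDl ltr_pdivrMr// => kL.
by rewrite -[k.+2]addn2 natrD; nra.
Qed.

Lemma window_size_bounds T (kappa : R) j : (2 <= T)%N -> 0 < kappa ->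
  let y := kappa * T%:R `^ ((1 - window_exponent T j) / 2) in
  [/\ 0 < y, y <= (window_size T kappa j)%:R &
      (window_size T kappa j)%:R < y + 1].
Proof.
move=> T2 kappa0 y; have y0 : 0 < y.
  by rewrite mulr_gt0// powR_gt0// ltr0n ltnW.
have eqn : (window_size T kappa j)%:R = (Num.ceil y)%:~R :> R.
  rewrite /window_size -/y pmulrn abszE ger0_norm// ceil_ge0.
  by rewrite (lt_trans (ltrN10 R)).
split=> //; rewrite eqn; first exact: ceil_ge.
by have := ceilB1_lt y; rewrite intrB; lra.
Qed.

Lemma window_size_antitone T (kappa : R) i j : (2 <= T)%N -> 0 < kappa ->
  (0 < i <= j)%N -> (window_size T kappa j <= window_size T kappa i)%N.
Proof.
move=> T2 kappa0 ij; rewrite -(ler_nat int).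
have [y0 _ _] := window_size_bounds j T2 kappa0.
have [z0 _ _] := window_size_bounds i T2 kappa0.
rewrite /window_size !natz !abszE !ger0_norm ?ceil_ge0 ?(lt_trans (ltrN10 R))//.
apply: le_ceil; rewrite ler_pM2l// !powR_natE ?(ltnW T2)// ler_expR.
have L0 : 0 < ln T%:R :> R by have := ln_nat_ge T2; lra.
by rewrite ler_pM2r//; have := window_exponent_mono T2 ij; lra.
Qed.

End Scales.

(** * Cumulative errors of the windows beyond the matching exponent *)

Section Accuracy.
Context {R : realType}.
Variables (T : nat) (kappa v : R) (mu : nat -> R) (j0 : nat).
Hypotheses (T2 : (2 <= T)%N) (kappa0 : 0 < kappa).
Hypothesis variation_le : demand_variation T mu <= T%:R `^ v.
Hypothesis v_le : v <= window_exponent T j0.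
Hypothesis window_large :
  2 <= kappa * T%:R `^ ((1 - window_exponent T j0) / 2).

(** The assumption [window_large] absorbs the rounding of the window size: if y
    is at least 2 and n is y rounded up, then (n + 1) / 2 <= y.  Shorter
    windows drift less. *)
Lemma drift_sum_le B n : (0 < n <= B)%N -> (n <= window_size T kappa j0)%N ->
  \sum_(B.+1 <= t < T.+1) `|n%:R^-1 * (\sum_(i < n) mu (t - i.+1)%N) - mu t|
  <= Num.sqrt kappa * T%:R `^ ((3 + window_exponent T j0) / 4).
Proof.
move=> /andP[n0 nB] nj0; have T0 : (0 < T)%N by exact: ltnW.
have [_ _ n_lt] := window_size_bounds j0 T2 kappa0.
have {n_lt} n_half : n.+1%:R / 2 <=
    kappa * T%:R `^ ((1 - window_exponent T j0) / 2).
  have : n%:R <= (window_size T kappa j0)%:R :> R by rewrite ler_nat.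
  by rewrite -natr1; move: n_lt window_large; lra.
have L0 : 0 < ln T%:R :> R by have := @ln_nat_ge R _ T2; lra.
have sk : 0 < Num.sqrt kappa by rewrite sqrtr_gt0.
(* With this [c] both terms of the AM-GM bound are at most [H]; the second
   one is where [v <= window_exponent T j0] enters. *)
pose c := Num.sqrt kappa * T%:R `^ ((window_exponent T j0 - 1) / 4).
have c0 : 0 < c by rewrite mulr_gt0// powR_gt0// ltr0n.
set H := Num.sqrt kappa * _.
have cT : c * T%:R = H.
  rewrite /c /H -mulrA -[X in _ * (_ * X)]powRr1 ?ler0n//.
  rewrite -powRD; last by rewrite pnatr_eq0 -lt0n T0 implybT.
  by congr (_ * _ `^ _); lra.
apply: le_trans (mean_drift_le T mu n0 nB c0) _.
suff : demand_variation T mu * (n.+1%:R / 2) / c <= H by rewrite cT; lra.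
rewrite ler_pdivrMr//.
apply: (@le_trans _ _ (T%:R `^ v *
    (kappa * T%:R `^ ((1 - window_exponent T j0) / 2)))).
  by rewrite ler_pM ?demand_variation_ge0// divr_ge0.
rewrite /H /c mulrACA -expr2 sqr_sqrtr ?(ltW kappa0)// [leLHS]mulrCA.
rewrite ler_pM2l//.
rewrite !powR_natE// -!expRD ler_expR -!mulrDl ler_pM2r//.
by move: v_le; lra.
Qed.

(** Summed over at most [T] periods, the pointwise noise bound becomes
    gamma sqrt (log T) T ^ ((3 + v_j) / 4); the drift is bounded by its value
    for [j0], whose power of [T] is smaller. *)
Lemma cumulative_error_lt (gamma mumin mumax : R) (d : nat -> R) B j tif t :
  0 < gamma -> (0 < j0 <= j)%N -> (window_size T kappa 1 <= B)%N ->
  (B < tif)%N -> (tif <= t <= T)%N ->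
  (forall s, (1 <= s <= T)%N -> mumin <= mu s <= mumax) ->
  (forall s, (B < s <= T)%N -> let n := window_size T kappa j in
    `|n%:R^-1 * \sum_(i < n) (d (s - i.+1)%N - mu (s - i.+1)%N)|
      < gamma * Num.sqrt (ln T%:R)
          * T%:R `^ ((window_exponent T j - 1) / 4)) ->
  \sum_(tif <= s < t.+1)
     `|mean_estimate T kappa mumin mumax d s j - mu s|
  < (gamma * Num.sqrt (ln T%:R) + Num.sqrt kappa)
      * T%:R `^ ((3 + window_exponent T j) / 4).
Proof.
move=> gamma0 /andP[j0_gt0 j0j] wB Btif /andP[tift tT] mu_in noise.
have T0 : (0 < T)%N by exact: ltnW.
set n := window_size T kappa j in noise *.
have [y0 yn _] := window_size_bounds j T2 kappa0.
have n0 : (0 < n)%N by rewrite -(ltr_nat R); exact: lt_le_trans yn.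
have nB : (n <= B)%N.
  apply: leq_trans wB; apply: window_size_antitone => //=.
  exact: leq_trans j0j.
set x := gamma * _ * _ in noise.
pose drift s := `|n%:R^-1 * (\sum_(i < n) mu (s - i.+1)%N) - mu s|.
have drift_le : \sum_(tif <= s < t.+1) drift s <=
    Num.sqrt kappa * T%:R `^ ((3 + window_exponent T j) / 4).
  apply: (@le_trans _ _ (\sum_(B.+1 <= s < T.+1) drift s)).
    rewrite [leRHS](big_cat_nat (n := tif)) //=; last by lia.
    rewrite [X in _ <= _ + X](big_cat_nat (n := t.+1)) //=; last by lia.
    rewrite addrCA lerDl addr_ge0// sumr_ge0// => s _; exact: normr_ge0.
  apply: le_trans (@drift_sum_le B n _ _) _; first by rewrite n0.
    by apply: window_size_antitone => //; rewrite j0_gt0.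
  rewrite ler_wpM2l ?sqrtr_ge0// !powR_natE// ler_expR.
  rewrite ler_wpM2r ?ln_ge0 ?ler1n//.
  have := @window_exponent_mono R T j0 j T2; rewrite j0_gt0 j0j => /(_ isT).
  by lra.
have pointwise s : (tif <= s < t.+1)%N ->
    `|mean_estimate T kappa mumin mumax d s j - mu s| < x + drift s.
  move=> sI; apply: le_lt_trans (mean_estimate_error_le _ _ _ _) _ => //.
  - by rewrite -/n; lia.
  - by apply: mu_in; lia.
  - by rewrite ltrD2r; apply: noise; lia.
apply: (@lt_le_trans _ _ (\sum_(tif <= s < t.+1) (x + drift s))).
  by apply: ltr_sum_nat.
rewrite big_split /= mulrDl lerD// sumr_const_nat -[_ *+ _]mulr_natr.
have -> : gamma * Num.sqrt (ln T%:R) * T%:R `^ ((3 + window_exponent T j) / 4)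
    = x * T%:R.
  rewrite /x -[RHS]mulrA -[X in _ = _ * (_ * X)]powRr1 ?ler0n//.
  rewrite -powRD; last by rewrite pnatr_eq0 -lt0n T0 implybT.
  by congr (_ * _ `^ _); lra.
rewrite ler_wpM2l ?ler_nat ?mulr_ge0 ?sqrtr_ge0 ?powR_ge0 ?ltW//; lia.
Qed.

End Accuracy.

Section Bounds.
Context {R : realType}.

(** The noise level is chosen so that n_j x ^ 2 >= kappa gamma ^ 2 log T for
    every window: the powers of [T] cancel. *)
Lemma noise_tail_le T (kappa gamma rho delta_eps : R) j : (2 <= T)%N ->
  0 < kappa -> 0 < rho -> 0 < delta_eps ->
  5 / 2 <= rho * kappa * gamma ^+ 2 / delta_eps ^+ 2 ->
  let n := window_size T kappa j in
  let x := gamma * Num.sqrt (ln T%:R)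
             * T%:R `^ ((window_exponent T j - 1) / 4) in
  2 * expR (- (rho * n%:R * x ^+ 2 / delta_eps ^+ 2))
    <= 2 * expR (- (5 / 2 * ln T%:R)) :> R.
Proof.
move=> T2 kappa0 rho0 delta0 large.
cbv zeta; set n := window_size T kappa j; set x := gamma * _ * _.
have T0 : (0 < T)%N by exact: ltnW.
have L0 : 0 < ln T%:R :> R by have := @ln_nat_ge R _ T2; lra.
have [y0 yn _] := window_size_bounds j T2 kappa0.
rewrite ler_pM2l// ler_expR lerN2.
apply: (@le_trans _ _ (rho * kappa * gamma ^+ 2 / delta_eps ^+ 2 * ln T%:R)).
  by rewrite ler_pM2r.
rewrite -[leLHS]mulrA (mulrC _^-1) mulrA ler_pM2r ?invr_gt0 ?exprn_gt0//.
rewrite /x !exprMn sqr_sqrtr ?(ltW L0)//.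
have cancel : T%:R `^ ((1 - window_exponent T j) / 2) *
    (T%:R `^ ((window_exponent T j - 1) / 4)) ^+ 2 = 1 :> R.
  rewrite !powR_natE// -expRM_natl -expRD -[RHS]expR0; congr expR.
  by rewrite mulr_natl; lra.
set p2 := (T%:R `^ ((_ - 1) / 4)) ^+ 2 in cancel *.
have p20 : 0 <= p2 by rewrite exprn_ge0// powR_ge0.
have : kappa <= n%:R * p2.
  apply: le_trans (ler_wpM2r p20 yn).
  by rewrite -mulrA cancel mulr1.
have rgL : 0 <= rho * (gamma ^+ 2 * ln T%:R).
  by rewrite mulr_ge0 ?(ltW rho0)// mulr_ge0 ?exprn_even_ge0// ltW.
move=> /(ler_wpM2l rgL); lra.
Qed.

(** The sub-Gaussian norm is an infimum, so the moment bound is available for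
    every constant above [delta], and then passes to the limit. *)
Lemma mean_le_subgaussian (mumin mumax delta : R) (D : R -> probability R R) :
  (forall mu : R, mumin <= mu <= mumax ->
     ('E_(D mu)[fun x : R => x] = mu%:E)%E) ->
  delta%:E = ereal_sup [set subgaussian_norm (D mu) (fun x : R => x)
     | mu in [set mu : R | mumin <= mu <= mumax]] ->
  forall mu, mumin <= mu <= mumax ->
    (\int[D mu]_x `|x|%:E < +oo)%E /\ `|mu| <= 4 * delta.
Proof.
move=> hmean hdelta mu hmu.
have moment K : delta < K -> (\int[D mu]_x `|x|%:E <= (4 * K)%:E)%E.
  move=> dK; apply: first_moment_le_subgaussian_norm.
  apply: (@le_lt_trans _ _ delta%:E); last by rewrite lte_fin.
  by rewrite hdelta; apply: ereal_sup_ubound; exists mu.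
split; first by apply: le_lt_trans (moment (delta + 1) _) _; rewrite ?ltrDl// ltry.
apply/ler_addgt0Pr => e e0.
have := le_trans (norm_mean_le_first_moment (hmean _ hmu)) (moment (delta + e / 4) _).
rewrite ltrDl divr_gt0// lee_fin => /(_ isT); lra.
Qed.

End Bounds.

(** * Regret of one period *)

Section Regret.
Context {R : realType}.
Variables (T : nat) (Q : set R) (Qmax bmax hmax mumin mumax ell : R).
Variables (b h : nat -> R) (D : R -> probability R R).
Hypothesis hQ : forall q, Q q -> 0 <= q <= Qmax.
Hypothesis hb : forall t, (1 <= t <= T)%N -> 0 <= b t <= bmax.
Hypothesis hh : forall t, (1 <= t <= T)%N -> 0 <= h t <= hmax.
Hypothesis moment : forall mu : R, mumin <= mu <= mumax ->
  (\int[D mu]_x `|x|%:E < +oo)%E.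
Hypothesis hlip : forall mu1 mu2 b0 h0 q : R,
  mumin <= mu1 <= mumax -> mumin <= mu2 <= mumax ->
  0 <= b0 <= bmax -> 0 <= h0 <= hmax -> Q q ->
  `|cost D mu1 b0 h0 q - cost D mu2 b0 h0 q| <= ell * `|mu1 - mu2|.

Lemma period_regret_le t mu q q' : (1 <= t <= T)%N -> mumin <= mu <= mumax ->
  Q q -> Q q' ->
  cost D mu (b t) (h t) q - cost D mu (b t) (h t) q'
    <= Num.max bmax hmax * Qmax.
Proof.
move=> tT mu_in Qq Qq'; have /andP[b0 bM] := hb tT; have /andP[h0 hM] := hh tT.
have Mb : 0 <= b t <= Num.max bmax hmax by rewrite b0 le_max bM.
have Mh : 0 <= h t <= Num.max bmax hmax by rewrite h0 le_max hM orbT.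
apply: le_trans (cost_lipschitz_in_order (moment mu_in) Mb Mh _ _) _.
rewrite ler_wpM2l//; first by case/andP: Mb => ? /(le_trans _); exact.
have /andP[? ?] := hQ Qq; have /andP[? ?] := hQ Qq'.
by rewrite ler_norml; lra.
Qed.

(** The estimated cost separates [q] from the optimum in the favourable
    direction; replacing the estimated mean by the true one at both orders
    costs twice the Lipschitz bound. *)
Lemma period_regret_le_error t mu mu' q q' : (1 <= t <= T)%N ->
  mumin <= mu <= mumax -> mumin <= mu' <= mumax ->
  argmin Q (cost D mu' (b t) (h t)) q -> Q q' ->
  cost D mu (b t) (h t) q - cost D mu (b t) (h t) q'
    <= 2 * ell * `|mu' - mu|.
Proof.
move=> tT mu_in mu'_in [Qq /(_ _ _)opt] Qq'; have opt' := opt _ Qq'.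
have := hlip mu'_in mu_in (hb tT) (hh tT) Qq.
have := hlip mu'_in mu_in (hb tT) (hh tT) Qq'.
by rewrite !ler_norml => /andP[? ?] /andP[? ?]; lra.
Qed.

End Regret.

(** * Numerical comparison with the claimed bound *)

Section Numerics.
Context {R : realType}.

Lemma burn_in_le T : (2 <= T)%N ->
  (burn_in (R := R) T <= T)%N /\
  (burn_in (R := R) T)%:R <= T%:R `^ (3 / 4) + 1 / 2 :> R.
Proof.
move=> T2; have T0 : (0 < T)%N by exact: ltnW.
have p0 : 0 <= T%:R `^ (3 / 4) + 1 / 2 :> R by rewrite addr_ge0// powR_ge0.
have Bp : (burn_in (R := R) T)%:R <= T%:R `^ (3 / 4) + 1 / 2 :> R.
  by rewrite /burn_in truncn_le.
split=> //; rewrite -ltnS -(ltr_nat R) -natr1; apply: le_lt_trans Bp _.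
suff : T%:R `^ (3 / 4) <= T%:R :> R by lra.
by rewrite -[leRHS]powRr1 ?ler0n// ler_powR ?ler1n//; lra.
Qed.

(** Used when T ^ (1 / 4) is below a power of log T. *)
Lemma trivial_bound T (v W X : R) : (2 <= T)%N -> 0 <= v -> 0 <= W ->
  T%:R `^ (1 / 4) <= 6 * (ln T%:R : R) `^ (5 / 2) -> 6 * W <= X ->
  T%:R * W <= X * T%:R `^ ((3 + v) / 4) * (ln T%:R) `^ (5 / 2).
Proof.
move=> T2 v0 W0 small WX; have T0 : (0 < T)%N by exact: ltnW.
have split_T : T%:R = T%:R `^ (3 / 4) * T%:R `^ (1 / 4) :> R.
  rewrite -powRD; last by rewrite pnatr_eq0 -lt0n T0 implybT.
  by rewrite -[LHS]powRr1 ?ler0n//; congr (_ `^ _); lra.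
rewrite [X in X * W]split_T.
have S0 : 0 <= T%:R `^ (3 / 4) :> R by exact: powR_ge0.
have SV : T%:R `^ (3 / 4) <= T%:R `^ ((3 + v) / 4) :> R.
  by rewrite ler_powR ?ler1n//; lra.
have Q0 : 0 <= T%:R `^ (1 / 4) :> R by exact: powR_ge0.
move: S0 SV Q0 small.
move: (T%:R `^ (3 / 4)) (T%:R `^ (1 / 4)) (T%:R `^ ((3 + v) / 4)) (ln _ `^ _) => S q V L.
move=> S0 SV q0 small.
have L0 : 0 <= L by lra.
apply: (@le_trans _ _ (S * (6 * L) * W)).
  by rewrite ler_wpM2r// ler_wpM2l.
have -> : S * (6 * L) * W = (6 * W) * S * L by ring.
by rewrite ler_wpM2r// ler_pM// mulr_ge0.
Qed.

(** Used when the window of exponent [w] has bounded size: then [kappa] is so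
    small that the summand of the constant in delta / sqrt kappa exceeds the
    cost of the largest possible estimation error in every period. *)
Lemma small_window_bound T (kappa delta ell v w W X : R) : (2 <= T)%N ->
  20 <= ln T%:R :> R -> 0 < kappa -> 0 <= delta -> 0 <= ell -> 0 <= v ->
  0 <= W ->
  kappa * T%:R `^ ((1 - w) / 2) < 2 ->
  T%:R `^ ((3 + w) / 4) <= expR (1 / 4) * T%:R `^ ((3 + v) / 4) ->
  3 * W + expR (1 / 4) * (ell * (Num.sqrt (pi / (36 * expR 1))
    * (delta / Num.sqrt kappa))) <= X ->
  W * (T%:R `^ (3 / 4) + 1 / 2) + T%:R * (2 * ell * (8 * delta))
  <= X * T%:R `^ ((3 + v) / 4) * (ln T%:R) `^ (5 / 2).
Proof.
move=> T2 L20 kappa0 delta0 ell0 v0 W0 small wv CX.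
have T0 : (0 < T)%N by exact: ltnW.
have T0' : T%:R != 0 :> R by rewrite pnatr_eq0 -lt0n.
have root : 1 / 10 <= Num.sqrt (pi / (36 * expR 1)) :> R.
  have -> : 1 / 10 = Num.sqrt ((1 / 10) ^+ 2) :> R.
    by rewrite sqrtr_sqr ger0_norm//; lra.
  rewrite ler_wsqrtr// ler_pdivlMr ?mulr_gt0 ?expR_gt0//.
  by have := @pi_ge2 R; have := @expR1_le4 R; lra.
have sk : 0 < Num.sqrt kappa by rewrite sqrtr_gt0.
have kT : T%:R * Num.sqrt kappa <= 2 * T%:R `^ ((3 + w) / 4).
  have split_T : T%:R = T%:R `^ ((1 - w) / 4) * T%:R `^ ((3 + w) / 4) :> R.
    rewrite -powRD; last by rewrite T0' implybT.
    by rewrite -[LHS]powRr1 ?ler0n//; congr (_ `^ _); lra.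
  rewrite [X in X * Num.sqrt _]split_T.
  rewrite mulrAC ler_wpM2r ?powR_ge0//.
  rewrite -(@ler_pXn2r _ 2)// ?nnegrE ?mulr_ge0 ?powR_ge0 ?(ltW sk)//.
  rewrite exprMn sqr_sqrtr ?(ltW kappa0)//.
  have -> : (T%:R `^ ((1 - w) / 4)) ^+ 2 = T%:R `^ ((1 - w) / 2) :> R.
    by rewrite -powR_mulrn ?powR_ge0// -powRrM; congr (_ `^ _); lra.
  by rewrite mulrC; lra.
have S1 : 1 <= T%:R `^ (3 / 4) :> R.
  by rewrite -[leLHS](powRr0 (T%:R)) ler_powR ?ler1n//; lra.
have SV : T%:R `^ (3 / 4) <= T%:R `^ ((3 + v) / 4) :> R.
  by rewrite ler_powR ?ler1n//; lra.
have L400 : 400 <= (ln T%:R : R) `^ (5 / 2).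
  rewrite powR_half_integer; last by lra.
  have s1 : 1 <= Num.sqrt (ln T%:R) :> R by rewrite -[leLHS]sqrtr1 ler_wsqrtr//; lra.
  have := ler_peMr (sqr_ge0 (ln T%:R : R)) s1; nra.
have E0 : 0 < expR (1 / 4) :> R by exact: expR_gt0.
move: (expR _) (Num.sqrt (pi / _)) (T%:R `^ (3 / 4)) (T%:R `^ ((3 + v) / 4))
  (T%:R `^ ((3 + w) / 4)) (_ `^ (5 / 2)) (Num.sqrt kappa)
  E0 root S1 SV wv L400 sk kT CX
  => E r S V Vw L s E0 r10 S1 SV wv L400 s0 kT CX.
have V0 : 0 <= V by lra.
have VL : 400 * V <= V * L by rewrite mulrC ler_wpM2l.
apply: (@le_trans _ _ ((3 * W + E * (ell * (r * (delta / s)))) * (V * L))); last first.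
  by rewrite -mulrA ler_wpM2r// mulr_ge0//; lra.
rewrite [leRHS]mulrDl lerD//.
  have : W * (S + 1 / 2) <= W * (3 * (V * L)) by rewrite ler_wpM2l//; lra.
  lra.
have -> : E * (ell * (r * (delta / s))) * (V * L) =
  (ell * delta) * (E * r * (V * L) / s) by field; rewrite gt_eqF.
have -> : T%:R * (2 * ell * (8 * delta)) = (ell * delta) * (16 * T%:R) by ring.
rewrite ler_wpM2l ?mulr_ge0// ler_pdivlMr//.
apply: (@le_trans _ _ (32 * (E * V))); first by lra.
have -> : E * r * (V * L) = (r * L) * (E * V) by ring.
rewrite ler_wpM2r ?mulr_ge0 ?(ltW E0)//.
have : 1 / 10 * L <= r * L by apply: ler_wpM2r => //; lra.
by lra.
Qed.

(** The terms in [ell] produce the second summand of the constant.  All terms in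
    [W] add up to at most W (T ^ (3 / 4) + 1 / 2 + 6 L ^ 2), which is below
    3 W T ^ (3 / 4) L ^ (5 / 2) since T ^ (3 / 4) >= 16. *)
Lemma main_bound T (kappa gamma ell v w W X : R) (j0 k B : nat) : (2 <= T)%N ->
  20 <= ln T%:R :> R -> 0 < kappa -> 0 < gamma -> 0 <= ell -> 0 <= v -> 0 <= W ->
  (0 < j0 <= k)%N -> k%:R <= 2 * ln T%:R ^+ 2 :> R ->
  B%:R <= T%:R `^ (3 / 4) + 1 / 2 :> R ->
  T%:R `^ ((3 + w) / 4) <= expR (1 / 4) * T%:R `^ ((3 + v) / 4) ->
  3 * W + 12 * expR (1 / 4) * ell * (gamma + Num.sqrt kappa) <= X ->
  (B%:R * W + j0%:R * (W + 2 * ell * (3 *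
     ((gamma * Num.sqrt (ln T%:R) + Num.sqrt kappa) * T%:R `^ ((3 + w) / 4)))))
  + T%:R * W * ((T * k)%:R * (2 * expR (- (5 / 2 * ln T%:R))))
  <= X * T%:R `^ ((3 + v) / 4) * (ln T%:R) `^ (5 / 2).
Proof.
move=> T2 L20 kappa0 gamma0 ell0 v0 W0 /andP[j00 j0k] kL BS wv CX.
have T0 : (0 < T)%N by exact: ltnW.
have j0k' : j0%:R <= k%:R :> R by rewrite ler_nat.
have tail : T%:R * T%:R * expR (- (5 / 2 * ln T%:R)) <= 1 :> R.
  rewrite -[X in X * X * _]powRr1 ?ler0n// powR_natE// -!expRD.
  by rewrite -[leRHS]expR0 ler_expR; lra.
have S16 : 16 <= T%:R `^ (3 / 4) :> R.
  by rewrite powR_natE//; apply: le_trans (expR_ge1Dx _); lra.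
have SV : T%:R `^ (3 / 4) <= T%:R `^ ((3 + v) / 4) :> R.
  by rewrite ler_powR ?ler1n//; lra.
have E0 : 0 < expR (1 / 4) :> R by exact: expR_gt0.
rewrite powR_half_integer; last by lra.
have s1 : 1 <= Num.sqrt (ln T%:R) :> R by rewrite -[leLHS]sqrtr1 ler_wsqrtr//; lra.
have sk : 0 <= Num.sqrt kappa by exact: sqrtr_ge0.
rewrite natrM.
have e0 : 0 <= expR (- (5 / 2 * ln T%:R)) :> R by exact: expR_ge0.
have t0 : 0 <= T%:R :> R by exact: ler0n.
move: (T%:R : R) (B%:R : R) (k%:R : R) (j0%:R : R) (Num.sqrt kappa) (ln _)
  (Num.sqrt (ln _)) (T%:R `^ ((3 + w) / 4)) (T%:R `^ ((3 + v) / 4))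
  (T%:R `^ (3 / 4)) (expR (- _)) (expR (1 / 4))
  (ler0n R j0) L20 tail S16 SV E0 s1 sk e0 t0 wv CX j0k' kL BS
  => t b K j s L sL Vw V S e E j_ge0 L20 tail S16 SV E0 s1 s0 e0 t0 wv CX jk kL bS.
have V0 : 0 <= V by lra.
have L2 : 400 <= L ^+ 2 by nra.
have LsL : L ^+ 2 <= L ^+ 2 * sL by rewrite ler_peMr//; lra.
set Y := V * (L ^+ 2 * sL).
have Y1 : V <= Y by rewrite /Y ler_peMr//; lra.
have Y2 : 16 * L ^+ 2 <= Y.
  by apply: (@le_trans _ _ (V * L ^+ 2)); rewrite ?ler_wpM2r ?ler_wpM2l//; lra.
have part1 : t * W * (t * K * (2 * e)) <= W * (2 * K).
  have -> : t * W * (t * K * (2 * e)) = (t * t * e) * (W * (2 * K)) by ring.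
  by rewrite ler_piMl// mulr_ge0//; lra.
have part2 : b * W + j * W + W * (2 * K) <= W * (3 * Y).
  rewrite -mulrDl mulrC -mulrDr ler_wpM2l//; lra.
have part3 : j * (2 * ell * (3 * ((gamma * sL + s) * Vw)))
    <= 12 * E * ell * (gamma + s) * Y.
  have -> : j * (2 * ell * (3 * ((gamma * sL + s) * Vw))) =
      (6 * ell) * (j * ((gamma * sL + s) * Vw)) by ring.
  have -> : 12 * E * ell * (gamma + s) * Y =
      (6 * ell) * ((2 * L ^+ 2) * (((gamma + s) * sL) * (E * V))).
    by rewrite /Y; ring.
  have g1 : gamma * sL + s <= (gamma + s) * sL.
    by rewrite mulrDl lerD2l ler_peMr.
  have g0 : 0 <= gamma * sL + s by rewrite addr_ge0// mulr_ge0; lra.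
  apply: ler_wpM2l; first by lra.
  apply: (@le_trans _ _ (j * (((gamma + s) * sL) * (E * V)))).
    apply: ler_wpM2l => //; apply: (@le_trans _ _ ((gamma * sL + s) * (E * V))).
      exact: ler_wpM2l.
    by apply: ler_wpM2r => //; rewrite mulr_ge0// ltW.
  apply: ler_wpM2r; last by lra.
  by rewrite !mulr_ge0//; lra.
have Y0 : 0 <= Y by lra.
rewrite -[leRHS]mulrA -/Y; apply: (@le_trans _ _ ((3 * W + 12 * E * ell * (gamma + s)) * Y)).
  rewrite mulrDr; lra.
exact: ler_wpM2r.
Qed.

Lemma constant_ge (M delta Qmax ell gamma s r E : R) :
  0 <= M -> 0 <= delta -> 0 <= Qmax -> 0 <= ell -> 0 <= gamma -> 0 <= s ->
  0 <= r -> 1 <= E ->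
  let C := 3 * M * (delta + Qmax) + 12 * E * ell * (gamma + s)
           + E * (3 * M * (delta + Qmax) + ell * (2 * s + r)) in
  [/\ 6 * (M * Qmax) <= C, 3 * (M * Qmax) + E * (ell * r) <= C &
      3 * (M * Qmax) + 12 * E * ell * (gamma + s) <= C].
Proof.
move=> M0 delta0 Qmax0 ell0 gamma0 s0 r0 E1.
have E0 : 0 <= E by exact: le_trans E1.
have Wd : M * Qmax <= M * (delta + Qmax) by rewrite ler_wpM2l ?lerDr.
have Z0 : 0 <= M * (delta + Qmax) by rewrite mulr_ge0 ?addr_ge0.
have g0 : 0 <= 12 * E * ell * (gamma + s).
  by rewrite mulr_ge0 ?addr_ge0// mulr_ge0// mulr_ge0.
have EZ : M * (delta + Qmax) <= E * (M * (delta + Qmax)) by rewrite ler_peMl.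
have Elr : 0 <= E * (ell * r) by rewrite mulr_ge0// mulr_ge0.
have Els : 0 <= E * (ell * s) by rewrite mulr_ge0// mulr_ge0.
move: Wd Z0 g0 EZ Elr Els; clear; split; lra.
Qed.

End Numerics.

(** * The regret bound *)

Theorem theorem1 (R : realType)
  (* problem data *)
  (T : nat) (Q : set R) (Qmax bmax hmax mumin mumax ell delta : R)
  (b h : nat -> R) (D : R -> probability R R)
  (hQ : forall q, Q q -> 0 <= q <= Qmax)
  (hb : forall t, (1 <= t <= T)%N -> 0 <= b t <= bmax)
  (hh : forall t, (1 <= t <= T)%N -> 0 <= h t <= hmax)
  (hmu : mumin <= mumax)
  (hmean : forall mu : R, mumin <= mu <= mumax ->
     ('E_(D mu)[fun x : R => x] = mu%:E)%E)
  (hsubg : forall mu : R, mumin <= mu <= mumax ->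
     (subgaussian_norm (D mu) (fun x : R => x) < +oo)%E)
  (hdelta : delta%:E = ereal_sup [set subgaussian_norm (D mu) (fun x : R => x)
     | mu in [set mu : R | mumin <= mu <= mumax]])
  (hell : 0 <= ell)
  (hlip : forall mu1 mu2 b0 h0 q : R,
     mumin <= mu1 <= mumax -> mumin <= mu2 <= mumax ->
     0 <= b0 <= bmax -> 0 <= h0 <= hmax -> Q q ->
     `|cost D mu1 b0 h0 q - cost D mu2 b0 h0 q| <= ell * `|mu1 - mu2|)
  (hargmin : forall (t : nat) (mu : R), (1 <= t <= T)%N -> mumin <= mu <= mumax ->
     argmin Q (cost D mu (b t) (h t)) !=set0)
  (* horizon and variation exponent *)
  (hT : (2 <= T)%N) (v : R) (hv : 0 <= v <= 1)
  (* policy parameters *)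
  (kappa gamma rho delta_eps : R) (hkappa : 0 < kappa) (hgamma : 0 < gamma)
  (hrho : hoeffding_constant rho)
  (hdelta_eps0 : 0 < delta_eps)
  (hdelta_eps : forall mu : R, mumin <= mu <= mumax ->
     (subgaussian_norm (D mu) (fun x : R => x - mu)%R <= delta_eps%:E)%E)
  (hlarge : 5 / 2 <= rho * kappa * gamma ^+ 2 / delta_eps ^+ 2)
  (k : nat) (hk0 : (1 <= k)%N)
  (hk : window_exponent T k.-1 < (1 : R) <= window_exponent T k)
  (hwd : (window_size T kappa 1 <= burn_in (R := R) T)%N)
  (p : forall t : nat, t.-1.-tuple R -> R)
  (hp : is_shrinking_policy T Q D mumin mumax b h kappa gamma k p) :
  let C0 := 3 * Num.max bmax hmax * (delta + Qmax)
            + ell * (2 * Num.sqrt kappa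
                     + Num.sqrt (pi / (36 * expR 1)) * (delta / Num.sqrt kappa))
  in
  exists C : R,
    C <= 3 * Num.max bmax hmax * (delta + Qmax)
         + 12 * expR (1 / 4) * ell * (gamma + Num.sqrt kappa)
         + expR (1 / 4) * C0 /\
    (worst_case_regret T Q D mumin mumax b h v p
       <= (C * T%:R `^ ((3 + v) / 4) * ln T%:R `^ (5 / 2))%:E)%E.
Proof.
set W0 := Num.max bmax hmax.
move=> C0; set C := _ + _; exists C; split=> //.
have one_in : (1 <= 1 <= T)%N by exact: ltnW.
have M0 : 0 <= W0.
  by have /andP[b0 b1] := hb _ one_in; rewrite le_max (le_trans b0).
have mumin_in : mumin <= mumin <= mumax by rewrite lexx.
have Qmax0 : 0 <= Qmax.
  have [q [Qq _]] := hargmin _ _ one_in mumin_in.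
  by have /andP[q0 /(le_trans q0)] := hQ _ Qq.
have delta0 : 0 <= delta.
  rewrite -lee_fin hdelta; apply: le_trans (subgaussian_norm_ge0 (D mumin) idfun) _.
  by apply: ereal_sup_ubound; exists mumin.
have means := @mean_le_subgaussian R mumin mumax delta D hmean hdelta.
have moment m (m_in : mumin <= m <= mumax) := (means m m_in).1.
have /andP[v0 v1] := hv.
set W := W0 * Qmax.
have W_ge0 : 0 <= W by exact: mulr_ge0.
have root0 : 0 <= Num.sqrt (pi / (36 * expR 1)) * (delta / Num.sqrt kappa).
  by rewrite mulr_ge0 ?sqrtr_ge0// divr_ge0 ?sqrtr_ge0.
have E1 : 1 <= expR (1 / 4) :> R.
  by apply: le_trans (expR_ge1Dx _); rewrite lerDl divr_ge0.
have [C6 Cr Cg] := constant_ge M0 delta0 Qmax0 hell (ltW hgamma)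
  (sqrtr_ge0 kappa) root0 E1.
apply: ge_ereal_sup => y [mu [qstar [d [Om [P [X [[mu_in hvar] hq hproc ->]]]]]]].
rewrite /regret.
set r := fun w t => cost D (mu t) (b t) (h t) (p t (history (X^~ w) t))
  - cost D (mu t) (b t) (h t) (qstar t).
set f := fun w : Om => _.
have fE w : f w = \sum_(1 <= t < T.+1) r w t by [].
have [pol pick] := hp.
have Qp w t : (1 <= t <= T)%N -> Q (p t (history (X^~ w) t)).
  by move=> /pol[_]; exact.
have r0 w t : (1 <= t <= T)%N -> 0 <= r w t.
  by move=> tT; rewrite subr_ge0; have [_] := hq _ tT; apply; exact: Qp.
have rW w t : (1 <= t <= T)%N -> r w t <= W.
  move=> tT; have [Qs _] := hq _ tT.
  by apply: (period_regret_le hQ hb hh moment) => //; [exact: mu_in|exact: Qp].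
have f0 w : 0 <= f w.
  by rewrite fE big_nat; apply: sumr_ge0 => t tI; exact: r0.
have sumW w m n : (0 < m)%N -> (n <= T)%N ->
    \sum_(m <= t < n.+1) r w t <= (n.+1 - m)%:R * W.
  move=> m0 nT; rewrite mulr_natl -sumr_const_nat big_nat [leRHS]big_nat.
  by apply: ler_sum => t tI; apply: rW; move: m0 nT tI; clear; lia.
have fTW w : f w <= T%:R * W by rewrite fE; have := sumW w 1%N T; rewrite subn1; exact.
pose B := burn_in (R := R) T.
have [BT BS] := @burn_in_le R T hT; rewrite -/B in BT BS.
have fB w : f w <= B%:R * W + \sum_(B.+1 <= t < T.+1) r w t.
  rewrite fE (big_cat_nat (n := B.+1)) //= lerD2r.
  by have := sumW w 1%N B isT BT; rewrite subn1.
(* The union bound over no bad event. *)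
have constant_bound a : 0 <= a -> (forall w, f w <= a) -> ('E_P[f] <= a%:E)%E.
  move=> a0 fa; rewrite -[a]addr0 -[X in _ + X](mul0r (#|'I_0|%:R * 0)).
  apply: (@expectation_le_union _ _ _ P 'I_0 (fun=> set0)) => //.
    by rewrite measure0.
  by move=> w; rewrite mul0r addr0.
have [small|large] := leP (T%:R `^ (1 / 4)) (6 * (ln T%:R : R) `^ (5 / 2)).
  apply: le_trans (constant_bound (T%:R * W) _ fTW) _; first exact: mulr_ge0.
  by rewrite lee_fin trivial_bound.
have L20 := ln_ge20 hT large.
have /andP[hk1 hk2] := hk.
have [j0 [/andP[j00 j0k] v_j0 vT]] := exists_matching_exponent hT hk0 hv hk2.
pose est w s j := mean_estimate T kappa mumin mumax (X^~ w) s j.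
pose idx w s := window_index T kappa gamma k mumin mumax (X^~ w) s.
have r_err w s : (B < s <= T)%N -> r w s <= 2 * ell * `|est w s (idx w s) - mu s|.
  move=> sT; have sT' : (1 <= s <= T)%N by move: sT; clear; lia.
  have [Qs _] := hq _ sT'.
  apply: (period_regret_le_error hb hh hlip) => //; first exact: mu_in.
    exact: mean_estimate_in.
  exact: (pick (X^~ w)).
(* In a tiny window the rounding of its size matters, but every error is at
   most the range of the means. *)
have [tiny|window_large] :=
    ltP (kappa * T%:R `^ ((1 - window_exponent T j0) / 2)) 2.
  apply: (le_trans (constant_bound
    (W * (T%:R `^ (3 / 4) + 1 / 2) + T%:R * (2 * ell * (8 * delta))) _ _)).
  - by rewrite addr_ge0// !mulr_ge0 ?addr_ge0 ?powR_ge0.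
  - move=> w; apply: le_trans (fB w) _; apply: lerD.
      by rewrite mulrC ler_wpM2l.
    apply: (@le_trans _ _ (\sum_(B.+1 <= t < T.+1) (2 * ell * (8 * delta)))).
      rewrite big_nat [leRHS]big_nat; apply: ler_sum => s sI.
      have sT : (B < s <= T)%N by move: sI; clear; lia.
      apply: le_trans (r_err w s sT) _; rewrite ler_wpM2l ?mulr_ge0//.
      have m1 : mumin <= mu s <= mumax by apply: mu_in; move: sT; clear; lia.
      have m2 : mumin <= est w s (idx w s) <= mumax by exact: mean_estimate_in.
      have := (means _ m1).2; have := (means _ m2).2.
      rewrite !ler_norml; clear => /andP[? ?] /andP[? ?].
      by apply/andP; lra.
    rewrite sumr_const_nat -[_ *+ _]mulr_natl ler_wpM2r ?mulr_ge0// ler_nat.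
    by rewrite subSS leq_subr.
  - by rewrite lee_fin; apply: (small_window_bound _ _ _ _ _ _ _ tiny).
pose x j := gamma * Num.sqrt (ln T%:R)
  * T%:R `^ ((window_exponent T j - 1) / 4).
have x0 j : 0 <= x j by rewrite !mulr_ge0 ?sqrtr_ge0 ?powR_ge0 ?ltW.
(* Indices are shifted: ['I_T] and ['I_k] start at 0, periods and windows
   at 1.  Windows reach back at most [B] periods, hence the test. *)
pose bad (tj : 'I_T * 'I_k) : set Om := if (B <= tj.1)%N then
  noise_event mu X (window_size T kappa tj.2.+1) tj.1.+1 (x tj.2.+1) else set0.
have mbad tj : measurable (bad tj).
  by rewrite /bad; case: ifP => // _; exact: measurable_noise_event.
have window_pos j : (0 < window_size T kappa j)%N.
  have [y0 yn _] := window_size_bounds j hT hkappa.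
  by rewrite -(ltr_nat R); exact: lt_le_trans yn.
have bad_le tj : (P (bad tj) <= (2 * expR (- (5 / 2 * ln T%:R)))%:E)%E.
  rewrite /bad; case: ifP => [Bt|_]; last by rewrite measure0 lee_fin mulr_ge0 ?expR_ge0.
  have mean t (tT : (1 <= t <= T)%N) := hmean _ (mu_in _ tT).
  have mom t (tT : (1 <= t <= T)%N) := moment _ (mu_in _ tT).
  have norm t (tT : (1 <= t <= T)%N) := hdelta_eps _ (mu_in _ tT).
  apply: le_trans (noise_event_le hproc mom mean hdelta_eps0 norm hrho _ _ (x0 _)) _.
  - rewrite window_pos ltnS; apply: leq_trans Bt; apply: leq_trans hwd.
    exact: window_size_antitone.
  - exact: ltn_ord.
  - by rewrite lee_fin; apply: noise_tail_le => //; case: hrho.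
set half := (gamma * Num.sqrt (ln T%:R) + Num.sqrt kappa)
  * T%:R `^ ((3 + window_exponent T j0) / 4).
pose a := B%:R * W + j0%:R * (W + 2 * ell * (3 * half)).
have half0 : 0 <= half.
  by rewrite mulr_ge0 ?powR_ge0// addr_ge0 ?mulr_ge0 ?sqrtr_ge0 ?ltW.
have error0 : 0 <= 2 * ell * (3 * half) by apply: mulr_ge0; exact: mulr_ge0.
have a0 : 0 <= a.
  by apply: addr_ge0; apply: mulr_ge0 => //; exact: addr_ge0.
have good w : (forall tj, ~ bad tj w) -> f w <= a.
  move=> wgood; apply: le_trans (fB w) _; rewrite lerD2l.
  apply: (phases_sum_le (k := k) (mu := mu)) => //.
  - by rewrite j00.
  - by rewrite mulr_ge0.
  - move=> j /andP[j0j jk]; apply: ler_wpM2l.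
      by rewrite addr_ge0 ?mulr_ge0 ?sqrtr_ge0 ?ltW.
    apply: ler_powR; first by rewrite ler1n ltnW.
    have := @window_exponent_mono R T j0 j hT; rewrite j00 j0j => /(_ isT).
    by clear; lra.
  - move=> j tif t /andP[j0j jk] Btif tI.
    apply: (@cumulative_error_lt R T kappa v mu j0 hT hkappa hvar v_j0
      window_large gamma mumin mumax (X^~ w) B j tif t) => //.
      by rewrite j00.
    move=> s /andP[Bs sT] /=; rewrite ltNge; apply/negP => noisy.
    have s1T : (s.-1 < T)%N by move: Bs sT; clear; lia.
    have j1k : (j.-1 < k)%N by move: j00 j0j jk; clear; lia.
    apply: (wgood (Ordinal s1T, Ordinal j1k)).
    rewrite /bad /= (_ : (B <= s.-1)%N); last first.
      by move: Bs; clear; lia.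
    have j_gt0 : (0 < j)%N by exact: leq_trans j0j.
    by rewrite !prednK//; exact: leq_trans Bs.
  - by move=> s sT; apply: rW; move: sT; clear; lia.
  - by move=> s; exact: r_err.
apply: le_trans (@expectation_le_union _ _ _ P _ bad f a (T%:R * W) _
  mbad a0 _ bad_le f0 _) _.
- exact: mulr_ge0.
- move=> w; have [[tj wbad]|/forallNP wgood] := pselect (exists tj, bad tj w).
    apply: le_trans (fTW w) _; rewrite (bigD1 tj) //= indicE mem_set//.
    have : 0 <= \sum_(i | i != tj) \1_(bad i) w :> R by exact: sumr_ge0.
    move: (T%:R * W) (mulr_ge0 (ler0n R T) W_ge0) a0 => c c0 a0 s0.
    by rewrite mulrDr mulr1 addrCA lerDl addr_ge0// mulr_ge0.
  apply: le_trans (good w wgood) _.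
  by rewrite lerDl mulr_ge0 ?mulr_ge0 ?sumr_ge0.
- rewrite lee_fin card_prod !card_ord.
  apply: main_bound => //; first by rewrite j00.
  apply: windows_count_le => //; apply: le_trans L20.
  by rewrite ler1n.
Qed.
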